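(* Let $G\cong C_{n_1}\oplus \cdots \oplus C_{n_r}$ be a finite abelian group with $r\ge 1$ and integers $1<n_1\mid n_2\mid \cdots \mid n_r$, and let $\beta_{\mathrm{sep}}(G)$ be the separating Noether number of $G$. (1) If $r=2s-1$ is odd, then $\beta_{\mathrm{sep}}(G)=n_s+n_{s+1}+\cdots+n_r$. (2) If $r=2s$ is even, then $\beta_{\mathrm{sep}}(G)=\frac{n_s}{p_1}+n_{s+1}+\cdots+n_r$, where $p_1$ is the minimal prime divisor of $n_1$.
   Context: $C_n$ denotes the cyclic group of order $n$. For a finite group $G$ acting linearly on a finite-dimensional complex vector space $V$ (a $G$-module), $G$ acts on the coordinate ring $\mathbb{C}[V]$, and $\mathbb{C}[V]^G$ is the ring of invariants. A subset $S\subseteq \mathbb{C}[V]^G$ is separating if for all $v,w\in V$ with $Gv\ne Gw$ there exists $f\in S$ with $f(v)\neq f(w)$. The separating Noether number $\beta_{\mathrm{sep}}(G)$ is the smallest positive integer $d$ such that for every finite-dimensional $G$-module $V$ over $\mathbb{C}$ there is a separating set consisting of invariant polynomials of degree at most $d$. *)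

(* Defs.v *)
From mathcomp Require Import all_boot all_order all_algebra all_fingroup.
From mathcomp Require Import all_solvable all_character.
From mathcomp Require Import classical_sets reals complex mpoly.

Set Implicit Arguments.
Unset Strict Implicit.
Unset Printing Implicit Defensive.


Local Open Scope ring_scope.
Local Open Scope classical_set_scope.

Section Invariants.
Variables (F : fieldType) (gT : finGroupType) (G : {group gT}).

Section Module.
(* The module is V = F^m, as row vectors, with g acting by v |-> v *m rV g;
   its coordinate ring F[V] is {mpoly F[m]}.  MathComp's representations act
   on the right, so the left action on F[V] is (g f)(v) = f (v *m rV g). *)
Variables (m : nat) (rV : mx_representation F G m).

Definition gorbit (v : 'rV[F]_m) : set 'rV[F]_m :=
  [set w | exists2 g : gT, g \in G & w = v *m rV g].

Definition poly_act (g : gT) (f : {mpoly F[m]}) : {mpoly F[m]} :=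
  f \mPo [tuple \sum_(j < m) rV g j i *: 'X_j | i < m].

Definition invariant_ring : set {mpoly F[m]} :=
  [set f | forall g : gT, g \in G -> poly_act g f = f].

Definition pt_eval (f : {mpoly F[m]}) (v : 'rV[F]_m) : F :=
  f.@[fun i => v 0 i].

Definition separating (S : set {mpoly F[m]}) : Prop :=
  S `<=` invariant_ring /\
  forall v w : 'rV[F]_m, gorbit v <> gorbit w ->
    exists2 f, S f & pt_eval f v <> pt_eval f w.

End Module.

(* msize f is 1 + the total degree of f, and 0 for f = 0 *)
Definition sep_degree_bound (d : nat) : Prop :=
  forall (m : nat) (rV : mx_representation F G m),
    exists2 S : set {mpoly F[m]},
      separating rV S & forall f, S f -> (msize f <= d.+1)%N.

Definition is_sep_noether_number (d : nat) : Prop :=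
  [/\ (0 < d)%N, sep_degree_bound d &
      forall d' : nat, (0 < d')%N -> sep_degree_bound d' -> (d <= d')%N].

End Invariants.

(* C_(n 1) (+) ... (+) C_(n r); 'Z_k is cyclic of order k only for k > 1 *)
Definition cyclic_sum (r : nat) (n : nat -> nat) : finGroupType :=
  {dffun forall i : 'I_r, (fun i : 'I_r => 'Z_(n i.+1) : finGroupType) i}.

(* Main.v *)
Require Import Defs.
From mathcomp Require Import all_boot all_order all_algebra all_fingroup.
From mathcomp Require Import all_solvable all_character.
From mathcomp Require Import classical_sets reals complex mpoly.
From mathcomp Require Import separable cyclotomic zify ring.
From mathcomp Require boolp.

(** Over the complex numbers a representation of an abelian group G is
    diagonalizable, so that an invariant is a combination of invariant
    monomials, and a monomial with exponents a is invariant exactly when a lies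
    in the lattice L of relations between the characters chi_x that occur.
    With G = C_(n 1) + ... + C_(n r), a relation is an integer vector a such
    that n i divides the sum of the a x * c x i for all i, where c x i are the
    coordinates of chi_x.

    Upper bound.  Two points on which the invariant monomials of degree at most
    d agree have the same support, and their quotient u satisfies u^b = 1 for
    all nonnegative relations b of length at most d.  If these b generate L
    then u^b = 1 on L, and orthogonality of characters yields an element of G
    that sends one point to the other (find_group_element).  So one must bound
    the length of relations generating L.  Suppose that u is not trivial on L;
    after raising u to a power, its values on L have p-power order.  Take a
    minimal support I on which u is not trivial, and the least power P of p
    that does not divide all relations on I.  Minimality forces every relation
    on I killed by u to be divisible by P (short_relations_generate), hence it
    is enough to find one relation that is nonnegative, short, and not
    divisible by P.  Minimality also gives #|I| <= 1 + #{i | P divides n i}.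
    Now take any relation a on I that P does not divide, and let q = n t with
    P | q.  Write a = y + q z with digits 0 <= y < q.  Replacing z by a
    nonnegative vector with the same value in the group q G changes a by a
    multiple of P only, and every element of a finite abelian group with
    invariants m_i is a sum of at most the sum of the m_i - 1 elements of any
    given set of generators (short_representative).  This leaves the digits to
    be estimated.  The digits of a and of -a add up to at most q #|I|, so one
    of the two costs at most half of that; this settles odd r, and all of even
    r but the case where P divides n 1 and #|I| can be r + 1.  There one uses
    the multiples s a with 0 < s < p: the sum of the digits of s a is determined
    mod q by s and the sum of a, and Dirichlet's approximation theorem makes it
    q/p-close to a multiple of q.

    Lower bound.  Choose characters that come in s pairs whose exponents are
    forced to add up to multiples of n i, for the s top values of i, and link
    the pairs by the lower components so that a relation with one vanishing
    pair has the distinguished exponent divisible by p = pdiv (n 1).  For even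
    r = 2 s one further character of order n s is linked in the same way and
    contributes n s / p.  The points (1,...,1) and (1,...,zeta_p,...,1) are then
    separated by no invariant of smaller degree (sep_degree_lower), and they lie
    in different orbits. *)

Set Implicit Arguments.
Unset Strict Implicit.
Unset Printing Implicit Defensive.

Import Order.TTheory GRing.Theory Num.Theory.
Local Open Scope ring_scope.

(** * Relation lattices and short representatives *)

Section Relations.
Variables (X : finType) (r : nat) (c : X -> 'I_r -> int).
Implicit Types (m : 'I_r -> nat) (I : {set X}) (a b z w : X -> int).

(** The relation lattice of elements with coordinates c x in the direct sum of
    the cyclic groups of order m i. *)
Definition is_relation m a : Prop :=
  forall i, (m i %| \sum_x a x * c x i)%Z.

Definition supported I a : Prop := forall x, x \notin I -> a x = 0.

Lemma is_relation_lin m a b (s t : int) :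
  is_relation m a -> is_relation m b -> is_relation m (fun x => s * a x + t * b x).
Proof.
move=> ra rb i.
under eq_bigr do rewrite mulrDl -!mulrA.
by rewrite big_split /= -!mulr_sumr rpredD // dvdz_mull.
Qed.

Lemma is_relation_ext m a b : a =1 b -> is_relation m a -> is_relation m b.
Proof. by move=> e ra i; under eq_bigr do rewrite -e; apply: ra. Qed.

End Relations.

(** The integral kernel is a direct summand, hence is not contained in p times
    the ambient lattice: in the Smith normal form, a row of the unimodular
    left factor's inverse beyond the rank is killed by the matrix, and it is
    nonzero mod p because that inverse is invertible mod p. *)
Lemma primitive_kernel (p : nat) (X T : finType) (b : X -> T -> int) :
  prime p -> (#|T| < #|X|)%N ->
  exists w : X -> int, (forall t, \sum_x w x * b x t = 0) /\
    exists x, ~~ (p %| w x)%Z.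
Proof.
move=> pp ltTX.
pose M : 'M[int]_(#|X|, #|T|) := \matrix_(i, j) b (enum_val i) (enum_val j).
have [L Lu [R Ru [d _ defM]]] := int_Smith_normal_form M.
pose k : 'I_#|X| := Ordinal ltTX.
pose v := row k (invmx L).
exists (fun x => v ord0 (enum_rank x)); split.
  move=> t.
  have vM : v *m M = 0.
    rewrite defM !mulmxA /v -row_mul mulVmx // -row_mul mul1mx.
    apply/rowP => j; rewrite !mxE big1 // => l _; rewrite !mxE.
    by rewrite gtn_eqF ?mulr0n ?mul0r.
  have := congr1 (fun u : 'rV_ _ => u ord0 (enum_rank t)) vM.
  rewrite !mxE; apply: etrans.
  rewrite (reindex (@enum_val X X)) /=; last by apply/onW_bij/enum_val_bij.
  by apply: eq_bigr => i _; rewrite enum_valK [M _ _]mxE enum_rankK.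
apply/existsP; rewrite -negb_forall; apply/negP => /forallP pv.
have : (p %| (v *m L) ord0 k)%Z.
  rewrite mxE; apply: rpred_sum => i _; rewrite dvdz_mulr //.
  by have := pv (enum_val i); rewrite enum_valK.
rewrite /v -row_mul mulVmx // !mxE eqxx dvdzE /= dvdn1 => /eqP p1.
by rewrite p1 in pp.
Qed.

Section Reduction.
Variables (X : finType) (r : nat) (c : X -> 'I_r -> int).
Implicit Types (m : 'I_r -> nat) (I : {set X}) (a b z w : X -> int).

(** Requiring w to vanish off I is one more linear condition for each element
    outside I, so that primitive_kernel applies as soon as #|J| < #|I|. *)
Lemma supported_kernel (p : nat) (J : {set 'I_r}) I :
  prime p -> (#|J| < #|I|)%N ->
  exists w, [/\ supported I w, forall i, i \in J -> \sum_x w x * c x i = 0 &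
    exists2 x, x \in I & ~~ (p %| w x)%Z].
Proof.
move=> pp ltJI.
pose T := ({i | i \in J} + {x | x \notin I})%type.
pose b (x : X) (t : T) : int :=
  match t with inl i => c x (val i) | inr y => (x == val y)%:R end.
have ltTX : (#|{: T}| < #|X|)%N.
  rewrite card_sum !card_sig -(cardC (mem I)) ltn_add2r.
  by rewrite (leq_ltn_trans _ ltJI) // leq_eqVlt; apply/orP; left; apply/eqP/eq_card.
have [w [wb [x xw]]] := primitive_kernel b pp ltTX.
have sw : supported I w.
  move=> y yI; have := wb (inr (exist _ y yI)).
  by rewrite (bigD1 y) //= eqxx mulr1 big1 ?addr0 // => z /negbTE->; rewrite mulr0.
exists w; split=> //.
  by move=> i iJ; apply: (wb (inl (exist _ i iJ))).
exists x => //; apply: contraNT xw => xI; by rewrite sw ?dvdz0.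
Qed.

(** The quotient of the group by p has dimension at most the number of moduli
    divisible by p.  A kernel vector supported on the support of z is a relation
    that allows one coordinate of z to be cleared mod p; this is repeated until
    the support is at most that dimension. *)
Lemma sparse_representative (p : nat) m I z :
  prime p -> (forall i, m i = 1%N \/ (p %| m i)%N) -> supported I z ->
  exists z' w, [/\ supported I z', supported I w,
    is_relation c m (fun x => z x - z' x - p%:Z * w x) &
    (#|[set x | z' x != 0]| <= #|[set i | (p %| m i)%N]|)%N].
Proof.
move=> pp hm; move: {2}_.+1 (ltnSn #|[set x | z x != 0]|) => N.
elim: N z => // N IH z; rewrite ltnS => leN sz.
have [le|gt] := leqP #|[set x | z x != 0%R]| #|[set i | (p %| m i)%N]|.
  exists z, (fun=> 0); split=> // i.
  by rewrite big1 ?dvdz0 // => x _; rewrite subrr mulr0 subr0 mul0r.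
have [b [sb kb [x0 x0z px0]]] := supported_kernel pp gt.
have rb : is_relation c m b.
  move=> i; have [->|pm] := hm i; first by rewrite dvd1z.
  by rewrite kb ?dvdz0 // inE.
have : coprimez p (b x0) by rewrite coprimezE /= prime_coprime.
case/coprimezP => -[u v] /= uv.
pose l := v * z x0.
(* u p + v (b x0) = 1, so l (b x0) = z x0 mod p and z - l b can be
   replaced by 0 at x0, modulo p; its support shrinks *)
pose z1 x := if x == x0 then 0 else z x - l * b x.
have zb x : z x = 0 -> b x = 0.
  by move=> zx; apply: sb; rewrite inE zx eqxx.
have sz1 : supported I z1.
  move=> x xI; rewrite /z1; case: ifP => // _.
  by rewrite sz // zb ?sz // mulr0 subr0.
have lt1 : (#|[set x | z1 x != 0%R]| < N)%N.
  apply: leq_trans leN; apply: proper_card; apply/properP; split.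
    apply/fintype.subsetP => x; rewrite !inE; apply: contraNN => /eqP zx.
    by rewrite /z1; case: ifP => // _; rewrite zx zb // mulr0 subr0.
  by exists x0 => //; rewrite !inE /z1 eqxx eqxx.
have [z' [w [sz' sw rw lew]]] := IH z1 lt1 sz1.
pose w' x := w x + (if x == x0 then u * z x0 else 0).
exists z', w'; split=> //.
  move=> x xI; rewrite /w' sw //; case: eqP => [e|_]; last by rewrite addr0.
  by move: x0z; rewrite inE -e sz // eqxx.
apply: is_relation_ext (is_relation_lin 1 l rw rb) => x.
rewrite /w' /z1; case: eqP => [->|_]; last by ring.
have -> : l * b x0 = z x0 - p%:Z * (u * z x0).
  rewrite /l -[X in X - _](mul1r) -uv; ring.
ring.
Qed.

(** In a subgroup of a finite abelian group with invariants m i, every element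
    of the subgroup generated by some elements is a sum of at most the sum of
    the m i - 1 of them.  Let p be a prime dividing the least m i > 1, hence all
    m i > 1.  Modulo p the element is a combination of few generators with
    coefficients less than p; the rest is p times an element of a group with
    invariants m i / p, and the induction bounds add up exactly. *)
Lemma short_representative m I z :
  (forall i, 0 < m i)%N -> (forall i j : 'I_r, (i <= j)%N -> (m i %| m j)%N) ->
  supported I z ->
  exists x : X -> nat, [/\ supported I (fun y => (x y)%:Z),
    is_relation c m (fun y => (x y)%:Z - z y) &
    (\sum_y x y <= \sum_i (m i).-1)%N].
Proof.
move: {2}_.+1 (ltnSn (\sum_i m i)) => N.
elim: N m z => // N IH m z; rewrite ltnS => leN m0 mch sz.
have [/existsP[i0 mi0]|] := boolP [exists i, m i != 1%N]; last first.
  rewrite negb_exists => /forallP m1; exists (fun=> 0%N); split=> //.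
    by move=> i; have := m1 i; rewrite negbK => /eqP->; rewrite dvd1z.
  by rewrite big1.
have [j mj jmin] := @arg_minnP _ i0 (fun i => m i != 1%N) (fun i => val i) mi0.
pose p := pdiv (m j).
have mj1 : (1 < m j)%N by rewrite ltn_neqAle eq_sym mj m0.
have pp : prime p by rewrite pdiv_prime.
have pm i : m i = 1%N \/ (p %| m i)%N.
  have [->|mi] := eqVneq (m i) 1%N; first by left.
  by right; apply: dvdn_trans (pdiv_dvd _) (mch _ _ (jmin _ mi)).
have [z' [w [sz' sw rz card_z']]] := sparse_representative pp pm sz.
pose m' i := if (p %| m i)%N then (m i %/ p)%N else m i.
have m'0 i : (0 < m' i)%N.
  rewrite /m'; case: ifP => // pmi.
  by rewrite divn_gt0 ?prime_gt0 // dvdn_leq.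
have m'ch (i k : 'I_r) : (i <= k)%N -> (m' i %| m' k)%N.
  rewrite /m' => ik; have := mch _ _ ik.
  have [mi|pmi] := pm i.
    rewrite mi (_ : (p %| 1)%N = false) ?dvd1n //.
    by rewrite dvdn1; apply/negbTE; rewrite neq_ltn prime_gt1 ?orbT.
  move=> mik; rewrite pmi (dvdn_trans pmi mik).
  by rewrite dvdn_divRL ?(dvdn_trans pmi) // divnK.
have m'lt : (\sum_i m' i < N)%N.
  apply: leq_trans leN.
  rewrite (bigD1 j) //= [X in (_ < X)%N](bigD1 j) //= -addSn leq_add //.
    by rewrite /m' pdiv_dvd ltn_Pdiv ?prime_gt1.
  apply: leq_sum => i _; rewrite /m'; case: ifP => // _; apply: leq_div.
pose v y := w y + (z' y %/ p)%Z.
have sv : supported I v by move=> y yI; rewrite /v sw // sz' // div0z.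
have [x1 [sx1 rx1 lex1]] := IH m' v m'lt m'0 m'ch sv.
pose x0 y := absz (z' y %% p)%Z.
have p_neq0 : p%:Z != 0 by rewrite eqz_nat -lt0n prime_gt0.
have x0E y : (x0 y)%:Z = (z' y %% p)%Z by rewrite /x0 gez0_abs ?modz_ge0.
(* z = x0 + p v up to a is_relation, and p (x1 - v) is a is_relation *)
exists (fun y => x0 y + p * x1 y)%N; split.
- move=> y yI; rewrite PoszD PoszM x0E sz' // mod0z.
  by have := sx1 _ yI => /= ->; rewrite mulr0.
- have rp : is_relation c m (fun y => p%:Z * ((x1 y)%:Z - v y)).
    move=> i; under eq_bigr do rewrite -mulrA.
    rewrite -mulr_sumr; have := rx1 i; rewrite /m'; case: ifP => [pmi d|_]; last first.
      exact: dvdz_mull.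
    by rewrite -(divnK pmi) PoszM mulrC dvdz_mul.
  apply: is_relation_ext (is_relation_lin (-1) 1 rz rp) => y.
  rewrite PoszD PoszM x0E /v {1}(divz_eq (z' y) p); ring.
rewrite big_split /= -big_distrr /=.
have le0 : (\sum_y x0 y <= #|[set i | p %| m i]| * p.-1)%N.
  apply: leq_trans (leq_mul card_z' (leqnn _)).
  rewrite -sum_nat_const big_mkcond /= [X in (_ <= X)%N]big_mkcond /=.
  apply: leq_sum => y _; rewrite inE; have [z0|_] := eqVneq.
    by rewrite -lez_nat x0E z0 mod0z.
  by rewrite -ltnS prednK ?prime_gt0 // -ltz_nat x0E ltz_pmod // ltz_nat prime_gt0.
apply: leq_trans (leq_add le0 (leq_mul (leqnn p) lex1)) _.
rewrite -sum_nat_const big_mkcond big_distrr /= -big_split /=.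
apply: leq_sum => i _; rewrite inE /m'; case: ifP => pmi.
  have p0 := prime_gt0 pp.
  have pmi_le : (p <= m i)%N by rewrite dvdn_leq.
  rewrite -!subn1 mulnBr muln1 mulnC divnK //; lia.
by have [->|] := pm i; rewrite ?muln0 ?pmi.
Qed.
End Reduction.

(** * Digit expansion of a relation *)

(** Dirichlet's approximation theorem for A / (Q p), in the sharp form needed
    here: the p multiples s A with s < p fall into p intervals of length Q.
    Either two lie in the same interval, and their difference is close to 0, or
    the last interval is hit, necessarily by s > 0. *)
Lemma dirichlet_multiple (A : int) (p Q : nat) :
  (1 < p)%N -> (0 < Q)%N -> exists2 s : nat, (0 < s < p)%N &
  (s%:Z * A %% (Q * p)%N)%Z <= Q%:Z \/ (Q * p - Q)%N%:Z <= (s%:Z * A %% (Q * p)%N)%Z.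
Proof.
move=> p1 Q0; pose q := (Q * p)%N.
have q0 : (0 < q)%N by rewrite muln_gt0 Q0; lia.
have q0z : q%:Z != 0 by rewrite eqz_nat; lia.
pose f (s : nat) := `|(s%:Z * A %% q)%Z|%N.
have fE s : (f s)%:Z = (s%:Z * A %% q)%Z by rewrite gez0_abs ?modz_ge0.
have fq s : (f s < q)%N by rewrite -ltz_nat fE ltz_pmod.
have gp s : (f s %/ Q < p)%N by rewrite ltn_divLR // mulnC.
pose g (s : 'I_p) : 'I_p := Ordinal (gp s).
have [/injectiveP inj|/injectivePn[s1 [s2 ne12 e12]]] := boolP (injectiveb g).
  have pm : (p.-1 < p)%N by lia.
  have [h _ hK] := injF_bij inj; pose s := h (Ordinal pm).
  have gs : (f s %/ Q = p.-1)%N by have /(congr1 val) := hK (Ordinal pm).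
  have fs : (p.-1 * Q <= f s)%N by rewrite -leq_divRL // gs.
  have s0 : s != 0%N :> nat.
    apply: contraTneq fs => ->; rewrite /f mul0r mod0z -ltnNge muln_gt0; lia.
  exists s; first by rewrite lt0n s0 ltn_ord.
  right; rewrite -fE lez_nat; apply: leq_trans fs; nia.
wlog lt12 : s1 s2 ne12 e12 / (s1 < s2)%N.
  move=> W; have [|gt|/val_inj e] := ltngtP s1 s2; first exact: W.
    by apply: (W s2 s1) => //; rewrite eq_sym.
  by rewrite e eqxx in ne12.
have e12' : (f s1 %/ Q = f s2 %/ Q)%N by have /(congr1 val) := e12.
have d1 := divn_eq (f s1) Q; have d2 := divn_eq (f s2) Q.
have m1 := ltn_pmod (f s1) Q0; have m2 := ltn_pmod (f s2) Q0.
have E : (((s2 - s1)%N%:Z * A) %% q)%Z = (((f s2)%:Z - (f s1)%:Z)%R %% q)%Z.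
  by rewrite !fE -subzn 1?ltnW // mulrBl modzDml -[RHS]modzDmr modzNm modzDmr.
exists (s2 - s1)%N; first by have := ltn_ord s2; lia.
rewrite E; have [le|gt] := leqP (f s1) (f s2).
  left; rewrite subzn // modz_small; last by have := fq s2; lia.
  by rewrite lez_nat; lia.
right; have -> : (f s2)%:Z - (f s1)%:Z = - (f s1 - f s2)%N%:Z by rewrite -subzn 1?ltnW //; ring.
rewrite -(modzDr _ q%:Z) modz_small; last by have := fq s1; lia.
have : (Q <= q)%N by rewrite /q leq_pmulr //; lia.
rewrite -/q; lia.
Qed.

Section Digits.
Variables (X : finType) (r : nat) (c : X -> 'I_r -> int).
Implicit Types (m : 'I_r -> nat) (I : {set X}) (a b z w : X -> int).

(** Write a = y + q z with digits y.  Only the class of z in q G matters, and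
    q G has invariants lcmn (m i) q / q, so that z may be replaced by a short
    nonnegative vector. *)
Lemma digit_reduction m I (q : nat) a :
  (0 < q)%N -> (forall i, 0 < m i)%N ->
  (forall i j : 'I_r, (i <= j)%N -> (m i %| m j)%N) ->
  supported I a -> is_relation c m a ->
  exists b : X -> nat, [/\ supported I (fun x => (b x)%:Z),
    is_relation c m (fun x => (b x)%:Z), forall x, (q %| (b x)%:Z - a x)%Z &
    (\sum_x b x <= \sum_x `|(a x %% q)%Z| + \sum_i (lcmn (m i) q - q))%N].
Proof.
move=> q0 m0 mch sa ra.
pose m' i := (lcmn (m i) q %/ q)%N.
have m'q i : (m' i * q = lcmn (m i) q)%N by rewrite divnK // dvdn_lcmr.
have m'0 i : (0 < m' i)%N by rewrite divn_gt0 // dvdn_leq ?lcmn_gt0 ?m0 // dvdn_lcmr.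
have m'ch (i j : 'I_r) : (i <= j)%N -> (m' i %| m' j)%N.
  move=> ij; rewrite -(dvdn_pmul2r q0) !m'q dvdn_lcm dvdn_lcmr andbT.
  by rewrite (dvdn_trans (mch _ _ ij)) // dvdn_lcml.
pose z x := (a x %/ q)%Z.
have sz : supported I z by move=> x xI; rewrite /z sa // div0z.
have [x [sx rx lex]] := short_representative c m'0 m'ch sz.
have q0z : q%:Z != 0 by rewrite eqz_nat -lt0n.
pose b y := (`|(a y %% q)%Z| + q * x y)%N.
have bE y : (b y)%:Z = a y + q%:Z * ((x y)%:Z - z y).
  rewrite /b PoszD PoszM gez0_abs ?modz_ge0 // /z {2}(divz_eq (a y) q); ring.
exists b; split.
- by move=> y yI; rewrite bE (sx _ yI) sz // sa // subrr mulr0 addr0.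
- have rq : is_relation c m (fun y => q%:Z * ((x y)%:Z - z y)).
    move=> i; under eq_bigr do rewrite -mulrA.
    rewrite -mulr_sumr mulrC; apply: (@dvdz_trans (m' i * q)%N).
      by rewrite m'q dvdzE /= dvdn_lcml.
    by rewrite PoszM dvdz_mul.
  by apply: is_relation_ext (is_relation_lin 1 1 ra rq) => y; rewrite bE; ring.
- by move=> y; rewrite bE addrC addKr dvdz_mulr.
rewrite big_split /= leq_add2l -big_distrr /=.
apply: leq_trans (leq_mul (leqnn q) lex) _; rewrite big_distrr /=.
by apply: leq_sum => i _; rewrite -m'q -subn1 mulnBr muln1 mulnC.
Qed.

End Digits.

(** * Divisor chains and short relations *)

Definition divisor_chain (n : nat -> nat) r : Prop :=
  (forall i, (1 <= i <= r)%N -> (1 < n i)%N) /\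
  (forall i, (1 <= i < r)%N -> (n i %| n i.+1)%N).

Lemma chain_dvd n r : divisor_chain n r ->
  forall i j, (1 <= i)%N -> (i <= j)%N -> (j <= r)%N -> (n i %| n j)%N.
Proof.
case=> _ ch i j i1; elim: j => [|j IH].
  by move=> ij; have -> : i = 0%N by lia.
rewrite leq_eqVlt => /orP[/eqP-> //|ij] jr.
by apply: dvdn_trans (IH _ _) (ch _ _); lia.
Qed.

Lemma chain_gt0 n r : divisor_chain n r ->
  forall i, (1 <= i)%N -> (i <= r)%N -> (0 < n i)%N.
Proof. by case=> h _ i i1 ir; apply: ltnW; apply: h; rewrite i1. Qed.

(** With q = n t in digit_reduction, only the moduli beyond t contribute to the
    second part of the bound. *)
Lemma sum_lcm_chain n r t : divisor_chain n r -> (1 <= t <= r)%N ->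
  ((r - t) * n t + \sum_(i < r) (lcmn (n i.+1) (n t) - n t) =
   \sum_(t.+1 <= i < r.+1) n i)%N.
Proof.
move=> ch /andP[t1 tr].
rewrite -(big_mkord xpredT (fun i => lcmn (n i.+1) (n t) - n t)%N).
rewrite -(@big_add1 _ _ _ 0 r.+1 xpredT (fun i => lcmn (n i) (n t) - n t)%N).
rewrite (@big_cat_nat _ _ _ t.+1) //= ?ltnS // big_nat_cond big1 ?add0n; last first.
  move=> i; rewrite andbT ltnS => /andP[i1 it].
  have /lcmn_idPr -> : (n i %| n t)%N by apply: (chain_dvd ch).
  by rewrite subnn.
have -> : ((r - t) * n t = \sum_(t.+1 <= i < r.+1) n t)%N.
  by rewrite sum_nat_const_nat subSS.
rewrite -big_split /= big_nat_cond [RHS]big_nat_cond; apply: eq_bigr => i.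
rewrite andbT ltnS => /andP[ti ir].
have dv : (n t %| n i)%N by apply: (chain_dvd ch) => //; exact: ltnW.
move/lcmn_idPl: (dv) => ->.
by rewrite subnKC // dvdn_leq // (chain_gt0 ch) // (leq_trans t1 (ltnW ti)).
Qed.

Lemma leq_cancel (u w k Q S : nat) :
  (w <= k + Q)%N -> (u + k <= w + S)%N -> (u <= Q + S)%N.
Proof. lia. Qed.

Lemma leq_split_half (u v K : nat) :
  (u + v <= 2 * K)%N -> (u <= K)%N \/ (v <= K)%N.
Proof. lia. Qed.

(** If u exceeds h q + Q and so does v, then u lies strictly between h q + Q and
    (h + 1) q - Q, so that its residue mod q is neither small nor large. *)
Lemma leq_split_window (u v h q Q : nat) :
  (u + v <= q * (2 * h + 1))%N -> (u %% q <= Q)%N \/ (q - Q <= u %% q)%N ->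
  (u <= h * q + Q)%N \/ (v <= h * q + Q)%N.
Proof.
move=> uv hu; have [le|gt] := leqP u (h * q + Q); [by left|right].
rewrite leqNgt; apply/negP => gt2.
have [D uE] : exists D, u = (h * q + D)%N.
  by exists (u - h * q)%N; rewrite subnKC // (leq_trans (leq_addr _ _) (ltnW gt)).
have uv' : (h * q + D + v <= h * q + h * q + q)%N.
  by move: uv; rewrite uE mulnDr muln1 mulnCA (mulnC q h) mul2n -addnn.
move: hu; rewrite uE modnMDl; move: gt gt2 uv'; rewrite uE.
move: (h * q)%N => K; rewrite ltn_add2l => QD KQ le.
rewrite modn_small; [|lia]; lia.
Qed.

Section Short.
Variables (X : finType) (r : nat) (c : X -> 'I_r -> int) (n : nat -> nat).
Hypothesis ch : divisor_chain n r.
Let nn (i : 'I_r) := n i.+1.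
Variables (I : {set X}) (p e : nat).
Hypothesis pp : prime p.
Let P := (p ^ e.+1)%N.
Variable a : X -> int.
Hypotheses (sa : supported I a) (ra : is_relation c nn a).
Hypothesis Pa : exists x, ~~ (P %| a x)%Z.

Let weight (q : nat) (s : int) := (\sum_x `|(s * a x %% q)%Z|)%N.

(** Since P divides n t, passing from s a to its reduction b does not change
    the class mod P, and b is still not divisible by P. *)
Lemma short_multiple t (s : int) : (1 <= t <= r)%N -> (P %| n t)%N ->
  ~~ (p %| s)%Z ->
  exists b : X -> nat, [/\ supported I (fun x => (b x)%:Z),
    is_relation c nn (fun x => (b x)%:Z), exists x, ~~ (P %| b x)%N &
    (\sum_x b x + (r - t) * n t <=
      weight (n t) s + \sum_(t.+1 <= i < r.+1) n i)%N].
Proof.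
move=> /andP[t1 tr] Pt ps.
have q0 : (0 < n t)%N by apply: (chain_gt0 ch).
have ra' : is_relation c nn (fun x => s * a x).
  by apply: is_relation_ext (is_relation_lin s 0 ra ra) => x; ring.
have sa' : supported I (fun x => s * a x) by move=> x xI; rewrite sa ?mulr0.
have [||b [sb rb bq leb]] := digit_reduction q0 _ _ sa' ra'.
- by move=> i; apply: (chain_gt0 ch).
- by move=> i j ij; apply: (chain_dvd ch).
exists b; split => //.
  have [x Pax] := Pa; exists x; apply: contra Pax => Pb.
  have : (P %| s * a x)%Z.
    rewrite -(subrK (b x)%:Z (s * a x)) rpredD //.
    by apply: (dvdz_trans (n := (n t)%:Z)) => //; rewrite -opprB rpredN.
  rewrite Gauss_dvdzr // coprimezE /= /P coprimeXl // prime_coprime //.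
rewrite -(sum_lcm_chain ch (t := t)) ?t1 // addnCA addnC leq_add2l.
exact: leb.
Qed.

Lemma weight_opp q s : (0 < q)%N ->
  (weight q s + weight q (- s) <= q * #|I|)%N.
Proof.
move=> q0; rewrite /weight -big_split /= mulnC -sum_nat_const [leqRHS]big_mkcond.
apply: leq_sum => x _; case: ifPn => xI; last by rewrite sa // !mulr0 mod0z.
set u := (s * a x); rewrite mulNr -/u.
have q0z : q%:Z != 0 by rewrite eqz_nat -lt0n.
rewrite -lez_nat PoszD !gez0_abs ?modz_ge0 //.
have [u0|u0] := eqVneq (u %% q)%Z 0.
  by rewrite u0 add0r ltW // ltz_pmod.
have -> : ((- u) %% q)%Z = q%:Z - (u %% q)%Z.
  rewrite -modzNm -(modzDr _ q%:Z) addrC modz_small //.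
  have := modz_ge0 u q0z; have := ltz_pmod u (d := q%:Z); rewrite ltz_nat q0 => /(_ isT).
  move=> h1 h2; rewrite subr_ge0 ltW //= ltrBlDr ltrDl lt_def u0 //.
by rewrite addrC subrK.
Qed.

(** The digits of a and -a sum to at most n t for each element of I; take the
    better of the two. *)
Lemma short_half t : (1 <= t <= r)%N -> (P %| n t)%N ->
  (#|I| <= 2 * (r - t + 1))%N ->
  exists b : X -> nat, [/\ supported I (fun x => (b x)%:Z),
    is_relation c nn (fun x => (b x)%:Z), exists x, ~~ (P %| b x)%N &
    (\sum_x b x <= \sum_(t <= i < r.+1) n i)%N].
Proof.
move=> tr Pt leI; have /andP[t1 t2] := tr.
have q0 : (0 < n t)%N by apply: (chain_gt0 ch).
have p1 := prime_gt1 pp.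
pose s : int := 1.
have ps1 : ~~ (p %| s)%Z by rewrite dvdzE /= dvdn1 gtn_eqF.
have psN1 : ~~ (p %| - s)%Z by rewrite rpredN.
have := leq_trans (weight_opp s q0) (leq_mul (leqnn (n t)) leI).
rewrite mulnCA (mulnC (n t)) => h2.
rewrite big_ltn ?ltnS //.
have [w1|w2] : (weight (n t) s <= (r - t + 1) * n t)%N \/
   (weight (n t) (- s) <= (r - t + 1) * n t)%N.
- exact: leq_split_half.
- have [b [sb rb Pb leb]] := short_multiple tr Pt ps1.
  exists b; split => //; apply: leq_cancel leb.
  by move: w1; rewrite mulnDl mul1n.
have [b [sb rb Pb leb]] := short_multiple tr Pt psN1.
exists b; split => //; apply: leq_cancel leb.
by move: w2; rewrite mulnDl mul1n.
Qed.

(** The estimate by half of n t #|I| would leave n t / 2 in place of n t / p.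
    But the digit sum of s a is determined mod n t by s and the sum of a, and
    for the s found by Dirichlet's theorem it is within n t / p of a multiple of
    n t; so the better of s a and - s a exceeds (r - t) n t by at most n t / p. *)
Lemma short_dirichlet t : (1 <= t <= r)%N -> (P %| n t)%N ->
  (#|I| <= 2 * (r - t) + 1)%N ->
  exists b : X -> nat, [/\ supported I (fun x => (b x)%:Z),
    is_relation c nn (fun x => (b x)%:Z), exists x, ~~ (P %| b x)%N &
    (\sum_x b x <= n t %/ p + \sum_(t.+1 <= i < r.+1) n i)%N].
Proof.
move=> tr Pt leI; have /andP[t1 t2] := tr.
have q0 : (0 < n t)%N by apply: (chain_gt0 ch).
have p1 := prime_gt1 pp.
have pt : (p %| n t)%N by apply: dvdn_trans Pt; rewrite /P expnS dvdn_mulr.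
pose Q := (n t %/ p)%N.
have QE : (Q * p = n t)%N by rewrite divnK.
have Q0 : (0 < Q)%N by rewrite divn_gt0 ?prime_gt0 // dvdn_leq.
have [s /andP[s0 sp]] := dirichlet_multiple (\sum_x a x) p1 Q0.
rewrite QE => hs.
have ps : ~~ (p %| s%:Z)%Z by rewrite dvdzE /= gtnNdvd.
have psN : ~~ (p %| - s%:Z)%Z by rewrite rpredN.
have h2 := leq_trans (weight_opp s q0) (leq_mul (leqnn (n t)) leI).
have wmod : ((weight (n t) s)%:Z %% n t)%Z = ((s%:Z * \sum_x a x)%R %% n t)%Z.
  apply/eqP; rewrite eqz_mod_dvd /weight (big_morph _ PoszD (erefl _)).
  rewrite mulr_sumr -sumrB rpred_sum // => x _.
  rewrite gez0_abs ?modz_ge0 ?eqz_nat -?lt0n //.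
  by rewrite -eqz_mod_dvd modz_mod.
have [w1|w2] : (weight (n t) s <= (r - t) * n t + Q)%N \/
   (weight (n t) (- s%:Z) <= (r - t) * n t + Q)%N.
- apply: leq_split_window h2 _; move: hs.
  by rewrite -wmod modz_nat !lez_nat.
- have [b [sb rb Pb leb]] := short_multiple tr Pt ps.
  by exists b; split => //; apply: leq_cancel w1 leb.
have [b [sb rb Pb leb]] := short_multiple tr Pt psN.
by exists b; split => //; apply: leq_cancel w2 leb.
Qed.

End Short.

(** * Minimal supports *)

Section Extremal.
Variables (X : finType) (r : nat) (c : X -> 'I_r -> int) (n : nat -> nat).
Hypothesis ch : divisor_chain n r.
Let nn (i : 'I_r) := n i.+1.
Variables (I : {set X}) (p e : nat).
Hypothesis pp : prime p.
Let P := (p ^ e.+1)%N.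
(** I is a minimal support of relations that P does not divide. *)
Hypothesis minI : forall b x, supported I b -> is_relation c nn b ->
  x \in I -> b x = 0 -> forall y, (P %| b y)%Z.
Variable a : X -> int.
Hypotheses (sa : supported I a) (ra : is_relation c nn a).
Hypothesis Pa : exists x, ~~ (P %| a x)%Z.

(** If I were larger, then even after removing one element x0 of I there would
    be a vector w on I, nonzero mod p, killed by all the coordinates with
    P | n i.  The other n i divide p^e N with N prime to p, so that p^e N w is a
    relation vanishing at x0 and not divisible by P, against minimality. *)
Lemma card_minimal_support : (#|I| <= #|[set i : 'I_r | (P %| n i.+1)%N]|.+1)%N.
Proof.
have [x0 Px0] := Pa.
have x0I : x0 \in I by apply: contraNT Px0 => xI; rewrite sa // dvdz0.
rewrite leqNgt; apply/negP; rewrite (cardsD1 x0) x0I ltnS => lt.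
have [w [sw kw [x1 x1I px1]]] := supported_kernel c pp lt.
pose N := ((n r)`_p^')%N.
have pN : coprime p N.
  by rewrite prime_coprime // -p'natE // part_pnat.
pose b x := (p ^ e * N)%N%:Z * w x.
have sb : supported I b.
  by move=> x xI; rewrite /b sw ?mulr0 // !inE (negbTE xI) andbF.
have rb : is_relation c nn b.
  move=> i; under eq_bigr do rewrite -mulrA.
  rewrite -mulr_sumr; have [iJ|] := boolP (i \in [set i : 'I_r | (P %| n i.+1)%N]).
    by rewrite kw // mulr0 dvdz0.
  rewrite inE => Pi; apply: dvdz_mulr; rewrite dvdzE /= /nn.
  have ni0 : (0 < n i.+1)%N by apply: (chain_gt0 ch).
  rewrite -(partnC p ni0) dvdn_mul //.
    by rewrite p_part dvdn_exp2l // -ltnS ltnNge; apply: contra Pi; rewrite -pfactor_dvdn.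
  by apply: partn_dvd; [apply: (chain_gt0 ch) => //; exact: leq_ltn_trans (ltn_ord i)|
     apply: (chain_dvd ch)].
have wx0 : b x0 = 0 by rewrite /b sw ?mulr0 // !inE eqxx.
have := minI sb rb x0I wx0 x1.
rewrite /b /P expnSr !PoszM -mulrA dvdz_mul2l; last first.
  by rewrite eqz_nat -lt0n expn_gt0 prime_gt0.
by rewrite Gauss_dvdzr ?(negbTE px1).
Qed.

Hypothesis r_gt0 : (0 < r)%N.

Lemma card_threshold j : (1 <= j <= r)%N ->
  (forall i, (1 <= i < j)%N -> ~~ (P %| n i)%N) -> (#|I| <= r - j + 2)%N.
Proof.
move=> /andP[j1 jr] hj; apply: leq_trans card_minimal_support _.
rewrite addn2 ltnS.
have -> : (r - j).+1 = #|[set i : 'I_r | (j <= i.+1)%N]|.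
  have -> : (r - j).+1 = (\sum_(j.-1 <= i < r) 1)%N by rewrite sum_nat_const_nat; lia.
  rewrite -sum1_card (@big_nat_widenl _ _ _ _ 0) // big_mkord.
  by apply: eq_bigl => i; rewrite inE /=; case: (j) j1.
apply/subset_leq_card/fintype.subsetP => i; rewrite !inE; apply: contraLR.
by rewrite -ltnNge => ij; apply: hj; rewrite ij.
Qed.

Let short d := exists b : X -> nat, [/\ supported I (fun x => (b x)%:Z),
    is_relation c nn (fun x => (b x)%:Z), exists x, ~~ (P %| b x)%N &
    (\sum_x b x <= d)%N].

(** If P does not divide the exponent n r of the group, then n r times a basis
    vector is the required relation. *)
Lemma short_unramified d : (n r <= d)%N -> ~~ (P %| n r)%N -> short d.
Proof.
move=> nd Pn; have [x0 Px0] := Pa.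
have x0I : x0 \in I by apply: contraNT Px0 => xI; rewrite sa // dvdz0.
exists (fun x => if x == x0 then n r else 0%N); split.
- by move=> x xI; case: eqP => // xx; rewrite -xx (negbTE xI) in x0I.
- move=> i; apply: rpred_sum => x _; case: eqP => _; last by rewrite mul0r dvdz0.
  by apply: dvdz_mulr; rewrite dvdzE /=; apply: (chain_dvd ch).
- by exists x0; rewrite eqxx.
by rewrite -big_mkcond big_pred1_eq.
Qed.

Lemma first_ramified : (P %| n r)%N -> exists j, [/\ (1 <= j <= r)%N, (P %| n j)%N &
  forall i, (1 <= i < j)%N -> ~~ (P %| n i)%N].
Proof.
move=> Pr; have ex : exists j, (0 < j)%N && (P %| n j)%N by exists r; rewrite r_gt0.
case: (ex_minnP ex) => j /andP[j0 Pj] jmin; exists j; split=> //.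
  by rewrite j0 jmin ?r_gt0.
move=> i /andP[i0 ij]; apply/negP => Pi; have := jmin i.
by rewrite i0 Pi leqNgt ij => /(_ isT).
Qed.

(** Let j be the first index with P | n j, so that #|I| <= r - j + 2.  With digits
    in base n t for t the larger of s and j, this is at most 2 (r - t + 1) as
    short_half demands. *)
Lemma short_odd s : r = (2 * s - 1)%N -> short (\sum_(s <= i < r.+1) n i).
Proof.
move=> rs.
have s1 : (1 <= s)%N by lia.
have sr : (s <= r)%N by lia.
have [Pr|Pr] := boolP (P %| n r)%N; last first.
  by apply: short_unramified Pr; rewrite big_nat_recr //= leq_addl.
have [j [/andP[j1 jr] Pj jmin]] := first_ramified Pr.
have cI : (#|I| <= r - j + 2)%N by apply: card_threshold jmin; rewrite j1.
pose t := maxn s j.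
have tr : (1 <= t <= r)%N by rewrite /t; lia.
have Pt : (P %| n t)%N by apply: dvdn_trans Pj _; apply: (chain_dvd ch); rewrite /t; lia.
have [|b [sb rb Pb leb]] := short_half ch pp sa ra Pa tr Pt.
  by apply: leq_trans cI _; rewrite /t; lia.
exists b; split=> //; apply: leq_trans leb _.
by rewrite (@big_cat_nat _ _ _ t s) /= ?leq_addl //; rewrite /t; lia.
Qed.

(** If j > 1 then #|I| <= r and short_half suffices, with t > s.  If P divides
    n 1 then #|I| can be r + 1, and short_dirichlet is used with t = s; its
    n s / p is at most the n s / pdiv (n 1) of the formula. *)
Lemma short_even s : r = (2 * s)%N ->
  short (n s %/ pdiv (n 1) + \sum_(s.+1 <= i < r.+1) n i).
Proof.
move=> rs.
have [Pr|Pr] := boolP (P %| n r)%N; last first.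
  by apply: short_unramified Pr; rewrite big_nat_recr /= ?addnA ?leq_addl //; lia.
have [j [/andP[j1 jr] Pj jmin]] := first_ramified Pr.
have cI : (#|I| <= r - j + 2)%N by apply: card_threshold jmin; rewrite j1.
have [j_eq1|j_neq1] := eqVneq j 1%N.
  have tr : (1 <= s <= r)%N by lia.
  have Pt : (P %| n s)%N by apply: dvdn_trans Pj _; apply: (chain_dvd ch); lia.
  have [|b [sb rb Pb leb]] := short_dirichlet ch pp sa ra Pa tr Pt.
    by apply: leq_trans cI _; lia.
  exists b; split=> //; apply: leq_trans leb _; rewrite leq_add2r leq_div2l ?pdiv_gt0 //.
  rewrite j_eq1 in Pj; apply: pdiv_min_dvd (prime_gt1 pp) _.
  by apply: dvdn_trans Pj; rewrite /P expnS dvdn_mulr.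
pose t := maxn s.+1 j.
have tr : (1 <= t <= r)%N by rewrite /t; clear -rs jr j1 r_gt0; lia.
have Pt : (P %| n t)%N by apply: dvdn_trans Pj _; apply: (chain_dvd ch); rewrite /t; lia.
have [|b [sb rb Pb leb]] := short_half ch pp sa ra Pa tr Pt.
  by apply: leq_trans cI _; rewrite /t; clear -rs jr j1 j_neq1; lia.
exists b; split=> //; apply: leq_trans leb _; apply: leq_trans (leq_addl _ _).
by rewrite (@big_cat_nat _ _ _ t s.+1) /= ?leq_addl //; rewrite /t; clear -rs jr j1; lia.
Qed.

End Extremal.

(** * From short relations to all relations *)

Section Detect.
Variables (X : finType) (r : nat) (c : X -> 'I_r -> int) (m : 'I_r -> nat).

(** This is the form in which the relations of length at most d are shown to
    generate all relations: prime by prime, and on supports I that are minimal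
    among those carrying a relation not divisible by p ^ e.+1. *)
Definition generated_below (d : nat) : Prop :=
  forall (I : {set X}) (p e : nat) (a : X -> int), prime p ->
  (forall b x, supported I b -> is_relation c m b ->
     x \in I -> b x = 0 -> forall y, ((p ^ e.+1)%N %| b y)%Z) ->
  supported I a -> is_relation c m a -> (exists x, ~~ ((p ^ e.+1)%N %| a x)%Z) ->
  exists b : X -> nat, [/\ supported I (fun x => (b x)%:Z),
    is_relation c m (fun x => (b x)%:Z), exists x, ~~ (p ^ e.+1 %| b x)%N &
    (\sum_x b x <= d)%N].

Variables (F : fieldType) (d N : nat) (I0 : {set X}) (u : X -> F).
Hypotheses (gen_d : generated_below d) (N_gt0 : (0 < N)%N).
Hypothesis uN : forall x, u x ^+ N = 1.
Hypothesis u_short : forall b : X -> nat, supported I0 (fun x => (b x)%:Z) ->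
  is_relation c m (fun x => (b x)%:Z) -> (\sum_x b x <= d)%N ->
  \prod_x u x ^+ b x = 1.

Lemma monomial_lin (w : X -> F) (a b : X -> int) (s t : int) :
  (forall x, w x != 0) ->
  \prod_x w x ^ (s * a x + t * b x) =
    (\prod_x w x ^ a x) ^ s * (\prod_x w x ^ b x) ^ t.
Proof.
move=> w0.
rewrite !(big_morph (fun y : F => y ^ _) (fun x y => expfzMl x y _) (exp1rz _ _)).
rewrite -big_split /=; apply: eq_bigr => x _.
by rewrite expfzDr // (mulrC s) (mulrC t) !exprz_exp.
Qed.

(** Suppose that u is not trivial on the relation b.  For a prime p dividing the
    order of the value, a power w of u takes values of p-power order on all
    relations and is still not trivial on b.  On a minimal support I for w, let
    p^e be the largest power of p dividing all relations.  A relation b' on I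
    killed by w is divisible by p^(e+1): otherwise a combination t a - s b'
    with t prime to p vanishes at some point of I, hence is killed by w,
    although w does not kill t a.  So a short relation not divisible by
    p^(e+1) is not killed by w, against the hypothesis. *)
Lemma short_relations_generate b : supported I0 (fun x => (b x)%:Z) ->
  is_relation c m (fun x => (b x)%:Z) -> \prod_x u x ^+ b x = 1.
Proof.
move=> sb rb; set om := \prod_x _; apply/eqP; apply: contraT => om1.
have omN : om ^+ N = 1.
  by rewrite /om -prodrXl big1 // => x _; rewrite exprAC uN expr1n.
have [o oprim odvd] := prim_order_exists N_gt0 omN.
have o1 : o != 1%N.
  by apply: contraNneq om1 => o1; rewrite -[om]expr1 -o1 prim_expr_order.
have o0 := prim_order_gt0 oprim.
pose p := pdiv o.
have pp : prime p by rewrite pdiv_prime // ltn_neqAle eq_sym o1.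
pose N' := (N`_p^')%N; pose q := (N`_p)%N.
pose w x := u x ^+ N'.
have w0 x : w x != 0.
  rewrite expf_neq0 //; apply/eqP => ux; have /eqP := uN x.
  by rewrite ux expr0n gtn_eqF // eq_sym oner_eq0.
pose psi (a : X -> int) := \prod_x w x ^ a x.
have psiq a : psi a ^+ q = 1.
  rewrite /psi -prodrXl big1 // => x _.
  by rewrite exprnP exprz_exp mulrC -exprz_exp -exprnP /w -exprM mulnC partnC // uN exp1rz.
pose nontriv I a := [/\ supported I a, is_relation c m a & psi a != 1].
pose bad (I : {set X}) := boolp.asbool (exists a, nontriv I a).
have bad0 : bad I0.
  apply/boolp.asboolP; exists (fun x => (b x)%:Z); split=> //.
  have -> : psi (fun x => (b x)%:Z) = om ^+ N'.
    by rewrite /psi /om -prodrXl; apply: eq_bigr => x _; rewrite -exprnP -exprM mulnC exprM.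
  rewrite -(prim_order_dvd oprim); apply/negP => oN'.
  have : (p %| N')%N by apply: dvdn_trans (pdiv_dvd _) oN'.
  by apply/negP; rewrite -p'natE // part_pnat.
have [I /minsetP[/boolp.asboolP[a [sa ra psia]] minI] subI] := minset_exists bad0.
have psi1 (J : {set X}) a' : J \proper I -> supported J a' -> is_relation c m a' -> psi a' = 1.
  move=> JI sa' ra'; apply/eqP; apply: contraT => psia'.
  have : bad J by apply/boolp.asboolP; exists a'.
  by move/(minI J) => /(_ (proper_sub JI)) JE; rewrite JE fintype.properxx in JI.
pose div e := boolp.asbool (forall a', supported I a' -> is_relation c m a' ->
   forall x, ((p ^ e)%N %| a' x)%Z).
have exdiv : exists e, ~~ div e.+1.
  have [x ax] : exists x, a x != 0.
    apply/existsP; rewrite -negb_forall; apply: contra psia => /forallP a0.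
    by rewrite /psi big1 // => x _; have /eqP -> := a0 x.
  exists `|a x|%N; apply/negP => /boolp.asboolP/(_ _ sa ra x).
  rewrite dvdzE /= => /dvdn_leq; rewrite absz_gt0 ax => /(_ isT).
  by rewrite leqNgt ltnW // ltn_expl // prime_gt1.
have [e ndiv emin] := ex_minnP exdiv.
have dive : div e.
  case: e emin {ndiv} => [|e] emin.
    by apply/boolp.asboolP => a' _ _ x; rewrite expn0 dvd1z.
  by apply: contraT => /emin; rewrite ltnn.
have key b' : supported I b' -> is_relation c m b' -> psi b' = 1 ->
    forall y, ((p ^ e.+1)%N %| b' y)%Z.
  move=> sb' rb' psib' y; apply: contraT => Pb'.
  have yI : y \in I by apply: contraNT Pb' => yI; rewrite sb' // dvdz0.
  have /dvdzP[t bt] := boolp.asboolW dive _ sb' rb' y.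
  have /dvdzP[s as_] := boolp.asboolW dive _ sa ra y.
  have pt : ~~ (p %| t)%Z.
    by apply: contra Pb' => pt; rewrite bt expnS PoszM dvdz_mul.
  pose a' x := t * a x + (- s) * b' x.
  have : psi a' = 1.
    apply: (@psi1 (I :\ y)); first by rewrite properD1.
      move=> x; rewrite !inE negb_and negbK => /orP[/eqP->|xI].
        by rewrite /a' bt as_; ring.
      by rewrite /a' sa // sb' // !mulr0 addr0.
    exact: is_relation_lin.
  rewrite /psi monomial_lin // -/(psi a) -/(psi b') psib' exp1rz mulr1 => psiat.
  have : coprimez t q.
    rewrite coprimezE /= coprime_sym /q p_part coprimeXl // prime_coprime //.
  case/coprimezP => -[x1 x2] /= x12.
  move: psia; rewrite -[psi a]expr1z -x12 expfzDr; last first.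
    by apply/prodf_neq0 => x _; rewrite expfz_neq0.
  by rewrite (mulrC x1) (mulrC x2) -!exprz_exp psiat -exprnP psiq !exp1rz mulr1 eqxx.
have [a1 [sa1 ra1 Pa1]] : exists a', [/\ supported I a', is_relation c m a' & exists x, ~~ ((p ^ e.+1)%N %| a' x)%Z].
  apply: boolp.contrapT => no; case/negP: ndiv; apply/boolp.asboolP => a' sa' ra' x.
  by apply: contraT => Px; case: no; exists a'; split=> //; exists x.
have [|b' [sb' rb' [y Py] leb']] := gen_d pp _ sa1 ra1 Pa1.
  move=> b' y sb' rb' yI by0; apply: key => //; apply: (@psi1 (I :\ y)) => //.
    by rewrite properD1.
  by move=> z; rewrite !inE negb_and negbK => /orP[/eqP-> //|zI]; rewrite sb'.
have sb'0 : supported I0 (fun x => (b' x)%:Z).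
  by move=> z zI; apply: sb'; apply: contra zI; apply/fintype.subsetP.
have psib' : psi (fun x => (b' x)%:Z) = 1.
  rewrite -(expr1n F N') -(u_short sb'0 rb' leb') /psi -prodrXl.
  by apply: eq_bigr => z _; rewrite -exprnP -exprM mulnC exprM.
by have := key _ sb' rb' psib' y; rewrite dvdzE /= (negbTE Py).
Qed.

End Detect.

(** * Roots of unity, diagonalization and coordinates *)

Section RootsOfUnity.
Variable F : numClosedFieldType.

Lemma unity_poly_split (N : nat) : (0 < N)%N ->
  exists2 rs : seq F, uniq rs & 'X^N - 1 = \prod_(z <- rs) ('X - z%:P).
Proof.
move=> N0; have [rs] := closed_field_poly_normal ('X^N - 1 : {poly F}).
rewrite (monicP (monic_Xn_sub_1 _ N0)) scale1r => rsE; exists rs => //.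
rewrite -separable_prod_XsubC -rsE separable_Xn_sub_1 //.
by rewrite pnatr_eq0 -lt0n.
Qed.

Lemma prim_root_exists (N : nat) : (0 < N)%N ->
  exists z : F, N.-primitive_root z.
Proof.
move=> N0; have [rs urs rsE] := unity_poly_split N0.
have /hasP[z _ zN] : has N.-primitive_root rs.
  apply: has_prim_root => //.
    apply/allP => z zrs; rewrite unity_rootE -subr_eq0.
    have : root ('X^N - 1) z by rewrite rsE root_prod_XsubC.
    by rewrite /root !hornerE.
  by rewrite -ltnS -(size_prod_XsubC rs id) -rsE size_Xn_sub_1.
by exists z.
Qed.

(** The minimal polynomial divides 'X^N - 1, which has simple roots. *)
Lemma diagonalizable_of_order m (A : 'M[F]_m) (N : nat) : (0 < N)%N ->
  iter N (mulmx A) 1%:M = 1%:M -> diagonalizable A.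
Proof.
case: m A => [|m] A N0 AN.
  exists 1%:M; first exact: unitmx1.
  by apply/is_diag_mxP => -[].
have [rs urs rsE] := unity_poly_split N0.
apply/diagonalizableP; exists rs => //; rewrite -rsE mxminpoly_min //.
rewrite rmorphB rmorphXn /= horner_mx_X rmorph1.
suff -> : A ^+ N = 1 by rewrite subrr.
by rewrite -[RHS]AN; elim: (N) => //= k <-; rewrite exprS.
Qed.

End RootsOfUnity.

Section Diagonalization.
Variables (F : numClosedFieldType) (gT : finGroupType) (G : {group gT}).

Lemma repr_abelian_diagonalizable m (rV : mx_representation F G m) : abelian G ->
  exists2 B : 'M[F]_m, B \in unitmx &
    forall g, g \in G -> exists D : 'rV[F]_m, rV g = invmx B *m diag_mx D *m B.
Proof.
move=> abG.
have [] := (codiagonalizableP [seq rV g | g <- enum G]).1.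
  split=> [A A'|A] /mapP[g]; rewrite mem_enum => gG ->.
    move=> /mapP[h]; rewrite mem_enum => hG ->.
    by rewrite /comm_mx -!repr_mxM // (centsP abG _ gG _ hG).
  apply: (@diagonalizable_of_order _ _ _ #[g]%g); first exact: order_gt0.
  have -> : iter #[g]%g (mulmx (rV g)) 1%:M = rV (g ^+ #[g]%g)%g.
    by elim: #[g]%g => [|k /= ->]; rewrite ?repr_mx1 // expgS repr_mxM ?groupX.
  by rewrite expg_order repr_mx1.
move=> B Bu /allP BD; exists B => // g gG.
have /BD : rV g \in [seq rV g | g <- enum G] by apply/map_f; rewrite mem_enum.
move=> /diagonalizable_forPex[D DE]; exists D.
by rewrite (simmxRL Bu DE) !mulmxA mulVmx // mul1mx mulmxKV.
Qed.

End Diagonalization.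

Lemma dfung1_1 (I : finType) (gT : I -> finGroupType) i :
  dfung1 (1%g : gT i) = 1%g.
Proof.
apply/ffunP => j; rewrite oneg_ffun.
by have [<-|ij] := eqVneq i j; rewrite ?dfung1_id ?dfung1_dflt.
Qed.

Section Coordinates.
Variables (gT : finGroupType) (G : {group gT}) (r : nat) (n : nat -> nat).
Hypothesis n_gt1 : forall i : 'I_r, (1 < n i.+1)%N.
Variable f : {morphism G >-> cyclic_sum r n}.
Hypotheses (f_inj : ('injm f)%g) (f_im : (f @* G)%g = [set: cyclic_sum r n]).

Definition cyc_coord (i : 'I_r) (g : gT) : nat := val (f g i).

Lemma cyc_coordM i : {in G &, forall g h,
  cyc_coord i (g * h)%g = (cyc_coord i g + cyc_coord i h) %% n i.+1}%N.
Proof.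
move=> g h gG hG; rewrite /cyc_coord morphM // mulg_ffun /=.
by congr modn; apply: Zp_cast.
Qed.

Lemma cyc_coord1 i : cyc_coord i 1%g = 0%N.
Proof. by rewrite /cyc_coord morph1 oneg_ffun. Qed.

Definition basis_elt (i : 'I_r) : gT :=
  invm f_inj (dfung1 (Zp1 : 'Z_(n i.+1)) : cyclic_sum r n).

Lemma basis_eltG i : basis_elt i \in G.
Proof.
have -> : (G : {set gT}) = (invm f_inj @* (f @* G))%g by rewrite im_invm.
by rewrite mem_morphim //= f_im inE.
Qed.

Lemma basis_eltK i : f (basis_elt i) = dfung1 (Zp1 : 'Z_(n i.+1)).
Proof. by rewrite /basis_elt invmK // f_im inE. Qed.

Lemma cyc_coord_basis i j : cyc_coord j (basis_elt i) = (i == j).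
Proof.
rewrite /cyc_coord basis_eltK; have [<-|ij] := eqVneq i j.
  by rewrite dfung1_id /= modn_small.
by rewrite dfung1_dflt.
Qed.

Lemma basis_eltX i k :
  f (basis_elt i ^+ k)%g = dfung1 ((Zp1 : 'Z_(n i.+1)) ^+ k)%g.
Proof.
rewrite morphX ?basis_eltG // basis_eltK.
by elim: k => [|k IH]; rewrite ?dfung1_1 // !expgS dfung1_morphM IH.
Qed.

(** Hence a character is determined by its values on the basis. *)
Lemma expand_basis g : g \in G ->
  g = (\prod_(i < r) basis_elt i ^+ cyc_coord i g)%g.
Proof.
move=> gG; set h := (\prod_i _)%g.
have bG i : (basis_elt i ^+ cyc_coord i g)%g \in G by rewrite groupX // basis_eltG.
have hG : h \in G by apply: group_prod.
apply: (injmP f_inj) => //; apply/ffunP => j.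
rewrite morph_prod // prodg_ffun (big_only1 j) //.
  by rewrite basis_eltX dfung1_id Zp1_expgz.
by move=> i ij _; rewrite basis_eltX dfung1_dflt.
Qed.

Lemma basis_expn i : (basis_elt i ^+ n i.+1)%g = 1%g.
Proof.
apply: (injmP f_inj); rewrite ?groupX ?basis_eltG //.
rewrite basis_eltX morph1 Zp_expg.
have -> : inZp ((Zp1 : 'Z_(n i.+1)) * n i.+1) = Zp0 :> 'I_(Zp_trunc (n i.+1)).+2.
  apply: val_inj; rewrite /= modnMml mul1n Zp_cast ?n_gt1 //.
  exact: modnn.
exact: dfung1_1.
Qed.

Section Characters.
Variables (F : fieldType) (chi : gT -> F).
Hypotheses (chi1 : chi 1%g = 1)
  (chiM : {in G &, {morph chi : g h / (g * h)%g >-> g * h}}).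

Lemma charX g k : g \in G -> chi (g ^+ k)%g = chi g ^+ k.
Proof. by move=> gG; elim: k => // k IH; rewrite expgS chiM ?groupX // IH exprS. Qed.

Lemma char_basis_order i : chi (basis_elt i) ^+ n i.+1 = 1.
Proof. by rewrite -charX ?basis_eltG // basis_expn. Qed.

Lemma char_expand g : g \in G -> chi g = \prod_i chi (basis_elt i) ^+ cyc_coord i g.
Proof.
move=> gG; rewrite {1}(expand_basis gG).
pose K (x : gT) (y : F) := (x \in G) /\ chi x = y.
suff [] : K (\prod_(i < r) basis_elt i ^+ cyc_coord i g)%g
   (\prod_i chi (basis_elt i) ^+ cyc_coord i g) by [].
apply: big_rec2; first by [].
move=> i y x _ [xG xE]; split; first by rewrite groupM ?groupX ?basis_eltG.
by rewrite chiM ?groupX ?basis_eltG // charX ?basis_eltG // xE.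
Qed.

End Characters.

End Coordinates.

(** * Characters *)

Section CharacterSums.
Variables (F : numClosedFieldType) (gT : finGroupType) (G : {group gT}).

Definition is_char (chi : gT -> F) : Prop :=
  chi 1%g = 1 /\ {in G &, {morph chi : g h / (g * h)%g >-> g * h}}.

Lemma is_char_monomial (X : finType) (chi : X -> gT -> F) (a : X -> nat) :
  (forall x, is_char (chi x)) -> is_char (fun g => \prod_x chi x g ^+ a x).
Proof.
move=> hchi; split.
  by rewrite big1 // => x _; rewrite (hchi x).1 expr1n.
move=> g h gG hG; rewrite -big_split; apply: eq_bigr => x _ /=.
by rewrite (hchi x).2 // exprMn.
Qed.

Lemma sum_char (psi : gT -> F) : is_char psi ->
  \sum_(g in G) psi g = if [forall g in G, psi g == 1] then #|G|%:R else 0.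
Proof.
move=> [psi1 psiM]; case: ifPn => [/forall_inP triv|].
  by rewrite (eq_bigr (fun=> 1)) ?sumr_const // => g gG; apply/eqP/triv.
rewrite negb_forall_in => /existsP[h /andP[hG psih]].
apply/eqP; have : psi h * \sum_(g in G) psi g = \sum_(g in G) psi g.
  rewrite mulr_sumr [RHS](reindex_inj (mulgI h)) /=.
  apply: eq_big => g; first by rewrite groupMl.
  by move=> gG; rewrite psiM.
move/eqP; rewrite -subr_eq0 -{2}[\sum_(_ in _) _]mul1r -mulrBl mulf_eq0.
by rewrite subr_eq0 (negbTE psih).
Qed.

(** The sum over t < N of (chi x g / u x)^t vanishes unless chi x g = u x, so
    one needs g for which the product of these sums over x is nonzero.  Summed
    over G and expanded, the product becomes a sum over exponents a of the
    character sums of chi^a, divided by u^a; by hypothesis u^a = 1 whenever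
    chi^a is trivial, so all terms are 0 or #|G|, and a = 0 contributes #|G|. *)
Lemma find_group_element (X : finType) (chi : X -> gT -> F) (u : X -> F) (N : nat) :
  (0 < N)%N -> (forall x, is_char (chi x)) ->
  (forall x g, g \in G -> chi x g ^+ N = 1) -> (forall x, u x ^+ N = 1) ->
  (forall a : X -> nat, (forall g, g \in G -> \prod_x chi x g ^+ a x = 1) ->
     \prod_x u x ^+ a x = 1) ->
  exists2 g, g \in G & forall x, chi x g = u x.
Proof.
move=> N0 hchi chiN uN hu.
have u0 x : u x != 0.
  apply/eqP => ux; have /eqP := uN x.
  by rewrite ux expr0n gtn_eqF // eq_sym oner_eq0.
pose T g x := \sum_(t < N) (chi x g / u x) ^+ t.
pose S := \sum_(g in G) \prod_x T g x.
pose val_a (a : {ffun X -> 'I_N}) := (fun x => val (a x)) : X -> nat.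
pose triv (a : X -> nat) := [forall g in G, \prod_x chi x g ^+ a x == 1].
have SE : S = \sum_(a : {ffun X -> 'I_N}) (if triv (val_a a) then #|G|%:R else 0).
  rewrite /S (eq_bigr (fun g => \sum_(a : {ffun X -> 'I_N})
     (\prod_x u x ^+ a x)^-1 * \prod_x chi x g ^+ a x)); last first.
    move=> g gG; rewrite bigA_distr_bigA; apply: eq_bigr => a _.
    rewrite -prodfV -big_split; apply: eq_bigr => x _ /=.
    by rewrite exprMn exprVn mulrC.
  rewrite exchange_big; apply: eq_bigr => a _ /=.
  rewrite -mulr_sumr (sum_char (is_char_monomial (val_a a) hchi)).
  rewrite -/(triv (val_a a)); case: ifPn => [|_]; last by rewrite mulr0.
  move=> /forall_inP tr; rewrite (hu (val_a a)) ?invr1 ?mul1r // => g gG.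
  exact/eqP/tr.
have S0 : S != 0.
  rewrite SE (bigD1 [ffun=> Ordinal N0]) //= ifT; last first.
    by apply/forall_inP => g _; rewrite big1 // => x _; rewrite /val_a ffunE.
  rewrite gt_eqF // ltr_wpDr ?ltr0n ?cardG_gt0 //.
  by apply: sumr_ge0 => a _; case: ifP.
have [g gG Tg] : exists2 g, g \in G & \prod_x T g x != 0.
  apply/exists_inP; apply: contraNT S0; rewrite negb_exists_in => /forall_inP no.
  by rewrite /S big1 // => g /no; rewrite negbK => /eqP.
exists g => // x; have /prodf_neq0/(_ x isT) Tgx := Tg.
have : (chi x g / u x - 1) * T g x = 0.
  by rewrite -subrX1 exprMn exprVn chiN // uN divr1 subrr.
move/eqP; rewrite mulf_eq0 (negbTE Tgx) orbF subr_eq0 => /eqP.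
by move=> /(congr1 (fun y => y * u x)); rewrite divfK // mul1r.
Qed.

End CharacterSums.

Section CharacterCoordinates.
Variables (F : numClosedFieldType) (gT : finGroupType) (G : {group gT}).
Variables (r : nat) (n : nat -> nat).
Hypothesis n_gt1 : forall i : 'I_r, (1 < n i.+1)%N.
Variable f : {morphism G >-> cyclic_sum r n}.
Hypotheses (f_inj : ('injm f)%g) (f_im : (f @* G)%g = [set: cyclic_sum r n]).
Let nn (i : 'I_r) := n i.+1.
Variable z : 'I_r -> F.
Hypothesis zP : forall i, (nn i).-primitive_root (z i).

Lemma char_exponent (chi : gT -> F) : is_char G chi ->
  exists c : 'I_r -> nat, forall i, chi (basis_elt f_inj i) = z i ^+ c i.
Proof.
move=> [chi1 chiM].
have ex i : exists k : 'I_(nn i), chi (basis_elt f_inj i) == z i ^+ k.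
  have [k kE] := prim_rootP (zP i) (char_basis_order n_gt1 f_inj f_im chi1 chiM i).
  by exists k; apply/eqP.
by exists (fun i => val (xchoose (ex i))) => i; apply/eqP/(xchooseP (ex i)).
Qed.

Variables (X : finType) (chi : X -> gT -> F) (c : X -> 'I_r -> nat).
Hypothesis chi_char : forall x, is_char G (chi x).
Hypothesis chi_c : forall x i, chi x (basis_elt f_inj i) = z i ^+ c x i.

(** A character is trivial as soon as it is trivial on the basis, where its
    values are powers of the roots of unity z i. *)
Lemma is_relation_char (a : X -> nat) :
  is_relation (fun x i => (c x i)%:Z) nn (fun x => (a x)%:Z) <->
  forall g, g \in G -> \prod_x chi x g ^+ a x = 1.
Proof.
pose psi g := \prod_x chi x g ^+ a x.
have [psi1 psiM] := is_char_monomial a chi_char.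
have psi_basis i : psi (basis_elt f_inj i) = z i ^+ (\sum_x a x * c x i)%N.
  rewrite /psi -prodrXr; apply: eq_bigr => x _.
  by rewrite chi_c -exprM mulnC.
have dvdE i : (nn i %| \sum_x (a x)%:Z * (c x i)%:Z)%Z =
    (psi (basis_elt f_inj i) == 1).
  rewrite psi_basis -(prim_order_dvd (zP i)).
  rewrite (eq_bigr (fun x => Posz (a x * c x i)%N)); last by move=> x _; rewrite PoszM.
  by rewrite -(big_morph Posz PoszD (erefl _)).
split=> [ra g gG|tr i].
  rewrite (char_expand f_inj f_im psi1 psiM gG) big1 // => i _.
  have := ra i; rewrite dvdE /psi => /eqP ->; exact: expr1n.
by rewrite dvdE /psi tr // basis_eltG.
Qed.

End CharacterCoordinates.

(** * The upper bound *)

Section LinearForms.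
Variables (F : fieldType) (gT : finGroupType) (G : {group gT}) (m : nat).
Variables (rV : mx_representation F G m) (B : 'M[F]_m) (chi : 'I_m -> gT -> F).
Hypothesis Bu : B \in unitmx.
Hypothesis rVE : forall g, g \in G ->
  rV g = invmx B *m diag_mx (\row_j chi j g) *m B.

(** Its value at v is the j-th coordinate of v in the basis of eigenvectors given
    by the rows of B. *)
Definition eigenform (j : 'I_m) : {mpoly F[m]} :=
  \sum_(i < m) invmx B i j *: 'X_i.

Definition eigenmonomial (a : 'I_m -> nat) : {mpoly F[m]} :=
  \prod_j eigenform j ^+ a j.

Lemma eigenform_eval j (v : 'rV[F]_m) :
  pt_eval (eigenform j) v = (v *m invmx B) 0 j.
Proof.
rewrite /pt_eval /eigenform raddf_sum mxE; apply: eq_bigr => i _ /=.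
by rewrite mevalZ mevalXU mulrC.
Qed.

Lemma eigenmonomial_eval a (v : 'rV[F]_m) :
  pt_eval (eigenmonomial a) v = \prod_j (v *m invmx B) 0 j ^+ a j.
Proof.
rewrite /pt_eval /eigenmonomial rmorph_prod; apply: eq_bigr => j _ /=.
by rewrite rmorphXn /= -[X in X ^+ _]/(pt_eval _ _) eigenform_eval.
Qed.

Lemma eigenform_act g j : g \in G ->
  poly_act rV g (eigenform j) = chi j g *: eigenform j.
Proof.
move=> gG; rewrite /poly_act /eigenform raddf_sum /=.
under eq_bigr => i _ do
  rewrite comp_mpolyZ comp_mpolyXU -tnth_nth tnth_mktuple scaler_sumr.
rewrite exchange_big scaler_sumr /=; apply: eq_bigr => k _.
under eq_bigr do rewrite scalerA.
rewrite -scaler_suml scalerA; congr (_ *: _).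
have -> : \sum_i invmx B i j * rV g k i = (rV g *m invmx B) k j.
  by rewrite mxE; apply: eq_bigr => i _; rewrite mulrC.
by rewrite rVE // mulmxK // mul_mx_diag !mxE mulrC.
Qed.

Lemma eigenmonomial_act g a : g \in G ->
  poly_act rV g (eigenmonomial a) = (\prod_j chi j g ^+ a j) *: eigenmonomial a.
Proof.
move=> gG; rewrite /poly_act /eigenmonomial rmorph_prod /=.
under eq_bigr => j _ do
  rewrite rmorphXn /= -/(poly_act rV g (eigenform j)) eigenform_act // exprZn.
by rewrite scaler_prod.
Qed.

Lemma eigenmonomial_msize a : (msize (eigenmonomial a) <= (\sum_j a j).+1)%N.
Proof.
have hom : eigenmonomial a \is (\sum_j a j).-homog.
  rewrite /eigenmonomial.
  pose K (k : nat) (q : {mpoly F[m]}) := is_true (q \is k.-homog).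
  suff : K (\sum_j a j)%N (\prod_j eigenform j ^+ a j) by [].
  apply: (big_rec2 K); first exact: dhomog1.
  move=> j k q _ Kq; apply: dhomogM => //.
  have form_hom : eigenform j \is 1.-homog.
    by apply: rpred_sum => i _; apply: dhomogZ; rewrite dhomogX /= mdeg1.
  by have := dhomogMn (a j) form_hom; rewrite mul1n.
rewrite msizeE; apply/bigmax_leqP_seq => k kq _.
by rewrite (dhomog_mf hom).
Qed.

End LinearForms.

Lemma supported_nat (X : finType) (I : {set X}) (b : X -> nat) x :
  supported I (fun y => (b y)%:Z) -> x \notin I -> b x = 0%N.
Proof. by move=> sb /sb/eqP; rewrite eqz_nat => /eqP. Qed.

Section Upper.
Variables (F : numClosedFieldType) (gT : finGroupType) (G : {group gT}).
Variables (r : nat) (n : nat -> nat).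
Hypothesis n_gt1 : forall i : 'I_r, (1 < n i.+1)%N.
Variable f : {morphism G >-> cyclic_sum r n}.
Hypotheses (f_inj : ('injm f)%g) (f_im : (f @* G)%g = [set: cyclic_sum r n]).
Let nn (i : 'I_r) := n i.+1.

Lemma cyclic_sum_abelian : abelian G.
Proof.
apply/centsP => g gG h hG; apply: (injmP f_inj); rewrite ?groupM //.
rewrite !morphM //; apply/ffunP => i; rewrite !mulg_ffun.
exact: Zp_mulgC.
Qed.

Lemma primitive_roots : exists z : 'I_r -> F, forall i, (nn i).-primitive_root (z i).
Proof.
have ex i : exists z : F, (nn i).-primitive_root z.
  exact: prim_root_exists (ltnW (n_gt1 i)).
by exists (fun i => xchoose (ex i)) => i; apply: (xchooseP (ex i)).
Qed.

(** Let v and w agree on the invariants of degree at most d.  Because N is at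
    most d, the N-th powers of their eigencoordinates agree, so that both have
    the same support I0, on which the quotient u is defined.  Off I0 both u and
    the characters are replaced by 1, which allows find_group_element to be
    applied to all coordinates at once. *)
Theorem sep_degree_bound_generated (d N : nat) :
  (0 < N)%N -> (forall i, nn i %| N)%N -> (N <= d)%N ->
  (forall m (c : 'I_m -> 'I_r -> int), generated_below c nn d) ->
  sep_degree_bound F G d.
Proof.
move=> N0 nN Nd gen m rV.
have [B Bu Bdiag] := repr_abelian_diagonalizable rV cyclic_sum_abelian.
pose chi (j : 'I_m) g := (B *m rV g *m invmx B) j j.
have rVE g : g \in G -> rV g = invmx B *m diag_mx (\row_j chi j g) *m B.
  move=> gG; have [D DE] := Bdiag g gG.
  rewrite {1}DE; congr (_ *m diag_mx _ *m _); apply/rowP => j.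
  rewrite !mxE /chi DE -!mulmxA mulmxV // mulmx1 mulmxA mulmxV // mul1mx.
  by rewrite mxE eqxx.
have chi_char j : is_char G (chi j).
  split=> [|g h gG hG]; first by rewrite /chi repr_mx1 mulmx1 mulmxV // mxE eqxx.
  have diagE k : k \in G -> B *m rV k *m invmx B = diag_mx (\row_j chi j k).
    by move=> kG; rewrite [in LHS]rVE // !mulmxA mulmxV // mul1mx mulmxK.
  rewrite {1}/chi repr_mxM // -(mulmxKV Bu (rV g)) -[_ *m B *m _]mulmxA.
  rewrite !mulmxA -(mulmxA _ B) -(mulmxA _ (B *m rV h)) !diagE //.
  by rewrite mul_diag_mx !mxE eqxx.
have [z zP] := primitive_roots.
have exc j := char_exponent n_gt1 f_inj f_im zP (chi_char j).
have [c cE] : exists c : 'I_m -> 'I_r -> nat,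
    forall j i, chi j (basis_elt f_inj i) = z i ^+ c j i.
  have [c cP] := boolp.choice exc; by exists c.
have relE a := is_relation_char f_im zP chi_char cE a.
exists [set q | invariant_ring rV q /\ (msize q <= d.+1)%N]%classic; last by move=> q [].
split=> [q []//|v w vw]; apply: boolp.contrapT => no.
have same q : invariant_ring rV q -> (msize q <= d.+1)%N -> pt_eval q v = pt_eval q w.
  move=> qi qs; apply: boolp.contrapT => ne; apply: no; by exists q.
pose v' := v *m invmx B; pose w' := w *m invmx B.
have mono (a : 'I_m -> nat) : is_relation (fun x i => (c x i)%:Z) nn (fun x => (a x)%:Z) ->
    (\sum_j a j <= d)%N -> \prod_j v' 0 j ^+ a j = \prod_j w' 0 j ^+ a j.
  move=> ra ad; rewrite -!eigenmonomial_eval; apply: same.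
    by move=> g gG; rewrite (eigenmonomial_act Bu rVE) // (relE a).1 // scale1r.
  exact: leq_trans (eigenmonomial_msize _ _) _.
have powN j : v' 0 j ^+ N = w' 0 j ^+ N.
  have := mono (fun k => if k == j then N else 0%N).
  rewrite -big_mkcond big_pred1_eq (bigD1 j) //= eqxx big1 ?mulr1; last first.
    by move=> k /negbTE ->.
  rewrite (bigD1 j) //= eqxx big1 ?mulr1; last by move=> k /negbTE ->.
  apply=> // i; rewrite (bigD1 j) //= eqxx big1 ?addr0.
    by rewrite dvdz_mulr // dvdzE /= nN.
  by move=> k /negbTE ->; rewrite mul0r.
pose I0 := [set j | v' 0 j != 0]%SET.
have w'0 j : j \notin I0 -> v' 0 j = 0 /\ w' 0 j = 0.
  rewrite inE negbK => /eqP v0; split=> //; apply/eqP.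
  by have := powN j; rewrite v0 expr0n gtn_eqF // => /esym/eqP; rewrite expf_eq0 N0.
pose u j := if j \in I0 then w' 0 j / v' 0 j else 1.
have uN j : u j ^+ N = 1.
  rewrite /u; case: ifP => [|_]; last exact: expr1n.
  by rewrite inE => v0; rewrite exprMn exprVn -powN divff // expf_neq0.
have u_short (b : 'I_m -> nat) : supported I0 (fun x => (b x)%:Z) ->
    is_relation (fun x i => (c x i)%:Z) nn (fun x => (b x)%:Z) ->
    (\sum_x b x <= d)%N -> \prod_x u x ^+ b x = 1.
  move=> sb rb bd; have := mono b rb bd.
  have -> : \prod_j w' 0 j ^+ b j = \prod_j v' 0 j ^+ b j * \prod_j u j ^+ b j.
    rewrite -big_split; apply: eq_bigr => j _ /=.
    have [jI|jI] := boolP (j \in I0).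
      rewrite /u jI -exprMn mulrC divfK //; by move: jI; rewrite inE.
    by rewrite (supported_nat sb jI) !expr0 ?mulr1 ?oner_neq0.
  have nz : \prod_j v' 0 j ^+ b j != 0.
    apply/prodf_neq0 => j _; have [|jI] := boolP (j \in I0).
      by rewrite inE => ?; rewrite expf_neq0.
    by rewrite (supported_nat sb jI) !expr0 ?mulr1 ?oner_neq0.
  by move/esym/eqP; rewrite -subr_eq0 -{2}[\prod_j _]mulr1 -mulrBr mulf_eq0 (negbTE nz) subr_eq0 => /eqP.
have utriv := short_relations_generate (gen m _) N0 uN u_short.
pose chi' j g := if j \in I0 then chi j g else 1.
have [||| |g gG gE] := @find_group_element F gT G _ chi' u N N0.
- move=> j; split=> [|g h gG hG]; rewrite /chi'; case: (j \in I0).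
  + exact: (chi_char j).1.
  + by [].
  + exact: (chi_char j).2.
  + by rewrite mulr1.
- move=> j g gG; rewrite /chi'; case: ifP => [_|_]; last exact: expr1n.
  have := (relE (fun k => if k == j then N else 0%N)).1 _ g gG.
  rewrite (bigD1 j) //= eqxx big1 ?mulr1; last by move=> k /negbTE ->.
  apply=> i; rewrite (bigD1 j) //= eqxx big1 ?addr0.
    by rewrite dvdz_mulr // dvdzE /= nN.
  by move=> k /negbTE ->; rewrite mul0r.
- exact: uN.
- move=> a atriv; pose a' j := if j \in I0 then a j else 0%N.
  have E (y y' : 'I_m -> F) : (forall j, y' j = if j \in I0 then y j else 1) ->
      \prod_j y' j ^+ a j = \prod_j y j ^+ a' j.
    move=> yE; apply: eq_bigr => j _; rewrite yE /a'; case: ifP => // _.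
    by rewrite expr1n.
  rewrite (E u u); last by move=> j; rewrite /u; case: ifP.
  apply: utriv; first by move=> j /negbTE; rewrite /a' => ->.
  apply/relE => g gG; rewrite -(E (chi^~ g) (chi'^~ g)) //; exact: atriv.
have wE : w = v *m rV g.
  apply: (can_inj (mulmxKV Bu)).
  apply/rowP => j; rewrite -/w' rVE // !mulmxA mulmxK // -/v' mul_mx_diag.
  rewrite [RHS]mxE [X in _ = _ * X]mxE.
  have := gE j; rewrite /chi' /u; case: ifPn => [jI ->|jI _].
    by rewrite mulrC divfK //; move: jI; rewrite inE.
  by have [-> ->] := w'0 j jI; rewrite mul0r.
apply: vw; apply/seteqP; split=> y [h hG ->].
  exists (g^-1 * h)%g; first by rewrite groupM ?groupV.
  by rewrite wE -mulmxA -repr_mxM ?groupM ?groupV // mulKVg.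
exists (g * h)%g; first by rewrite groupM.
by rewrite wE -mulmxA -repr_mxM.
Qed.

End Upper.

(** * The criterion for the lower bound *)

Section Lower.
Variables (F : numClosedFieldType) (gT : finGroupType) (G : {group gT}).
Variables (r : nat) (n : nat -> nat).
Hypothesis n_gt1 : forall i : 'I_r, (1 < n i.+1)%N.
Variable f : {morphism G >-> cyclic_sum r n}.
Hypotheses (f_inj : ('injm f)%g) (f_im : (f @* G)%g = [set: cyclic_sum r n]).
Let nn (i : 'I_r) := n i.+1.
Variable z : 'I_r -> F.
Hypothesis zP : forall i, (nn i).-primitive_root (z i).

Definition char_of (c : 'I_r -> nat) (g : gT) : F :=
  \prod_i z i ^+ (c i * cyc_coord f i g).

Lemma char_of_is_char c : is_char G (char_of c).
Proof.
split=> [|g h gG hG].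
  by rewrite /char_of big1 // => i _; rewrite cyc_coord1 muln0.
rewrite -big_split; apply: eq_bigr => i _ /=.
rewrite cyc_coordM // -exprD -mulnDr; apply/eqP.
by rewrite (eq_prim_root_expr (zP i)) modnMmr.
Qed.

Lemma char_of_basis c i : char_of c (basis_elt f_inj i) = z i ^+ c i.
Proof.
rewrite /char_of (bigD1 i) //= cyc_coord_basis // eqxx muln1 big1 ?mulr1 // => j ij.
by rewrite cyc_coord_basis // eq_sym (negbTE ij) muln0.
Qed.

Section Diagonal.
Variables (m : nat) (c : 'I_m -> 'I_r -> nat).

Definition diag_of (g : gT) : 'M[F]_m := diag_mx (\row_j char_of (c j) g).

Lemma diag_of_repr : mx_repr G diag_of.
Proof.
split=> [|g h gG hG].
  rewrite /diag_of -[1%:M]diag_const_mx; congr diag_mx; apply/rowP => j.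
  by rewrite !mxE (char_of_is_char (c j)).1.
rewrite /diag_of mulmx_diag; congr diag_mx; apply/rowP => j.
by rewrite !mxE (char_of_is_char (c j)).2.
Qed.
Definition diag_rep := MxRepresentation diag_of_repr.

Lemma poly_act_coef g (q : {mpoly F[m]}) k :
  (poly_act diag_rep g q)@_k = (\prod_j char_of (c j) g ^+ k j) * q@_k.
Proof.
rewrite /poly_act.
set lq := [tuple _ | _ < _].
have lqE i : tnth lq i = char_of (c i) g *: 'X_i.
  rewrite tnth_mktuple (bigD1 i) //= big1 ?addr0.
    by rewrite /diag_of !mxE eqxx mulr1n.
  by move=> j ji; rewrite /diag_of !mxE (negbTE ji) mulr0n scale0r.
have monoE (l : 'X_{1.. m}) :
    'X_[l] \mPo lq = (\prod_j char_of (c j) g ^+ l j) *: 'X_[l].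
  rewrite comp_mpolyX (eq_bigr (fun i => (char_of (c i) g ^+ l i) *: ('X_i ^+ l i))).
    by rewrite scaler_prod -mpolyXE_id.
  by move=> i _; rewrite lqE exprZn.
rewrite comp_mpolyEX raddf_sum /=.
under eq_bigr do rewrite monoE scalerA mcoeffZ mcoeffX.
have [kq|kq] := boolP (k \in msupp q); last first.
  rewrite big_seq big1 ?(memN_msupp_eq0 kq) ?mulr0 // => l lq'.
  by case: eqP => [lk|]; rewrite ?mulr0 // -lk lq' in kq *.
rewrite (bigD1_seq k) ?msupp_uniq //= eqxx mulr1 [X in _ + X]big1 ?addr0 1?mulrC //.
by move=> l /negbTE ->; rewrite mulr0.
Qed.

End Diagonal.

(** Invariants are combinations of invariant monomials; those of degree less
    than d have exponent at x0 divisible by p, and do not separate the points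
    (1,...,1) and (1,...,zeta_p,...,1), with zeta_p at x0.  A relation with
    exponent at x0 prime to p shows that no group element maps one point to
    the other. *)
Lemma sep_degree_lower_ord m (c : 'I_m -> 'I_r -> nat) (x0 : 'I_m) (p d d' : nat) :
  prime p ->
  (forall a : 'I_m -> nat,
     is_relation (fun x i => (c x i)%:Z) nn (fun x => (a x)%:Z) ->
     (\sum_x a x < d)%N -> (p %| a x0)%N) ->
  (exists2 a : 'I_m -> nat,
     is_relation (fun x i => (c x i)%:Z) nn (fun x => (a x)%:Z) & ~~ (p %| a x0)%N) ->
  sep_degree_bound F G d' -> (d <= d')%N.
Proof.
move=> pp short [a0 ra0 pa0] sep; rewrite leqNgt; apply/negP => lt.
have [om omP] := prim_root_exists F (prime_gt0 pp).
have relE a := is_relation_char f_im zP (fun x => char_of_is_char (c x))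
   (fun x i => char_of_basis (c x) i) a.
have [S [Sinv Ssep] Ssize] := sep _ (diag_rep c).
pose v : 'rV[F]_m := const_mx 1.
pose w : 'rV[F]_m := \row_j (if j == x0 then om else 1).
have wprod (a : 'I_m -> nat) : \prod_j w 0 j ^+ a j = om ^+ a x0.
  rewrite (bigD1 x0) //= mxE eqxx big1 ?mulr1 // => j /negbTE jx.
  by rewrite mxE jx expr1n.
have [|q Sq] := Ssep v w.
  move=> vw; have : gorbit (diag_rep c) w w.
    by exists 1%g; rewrite ?group1 // repr_mx1 mulmx1.
  rewrite -vw => -[g gG wE]; case/negP: pa0.
  rewrite (prim_order_dvd omP) -wprod; apply/eqP.
  rewrite -[RHS]((relE a0).1 ra0 g gG); apply: eq_bigr => j _.
  by rewrite wE /= mul_mx_diag !mxE mul1r.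
apply; rewrite /pt_eval !mevalE; apply: eq_big_seq => k kq; congr (_ * _).
rewrite wprod; transitivity (1 : F).
  by rewrite big1 // => j _; rewrite mxE expr1n.
apply/esym/eqP; rewrite -(prim_order_dvd omP); apply: short.
  apply/relE => g gG; have := congr1 (mcoeff k) (Sinv _ Sq g gG).
  rewrite poly_act_coef => /eqP; rewrite -subr_eq0 -{2}[q@_k]mul1r -mulrBl mulf_eq0.
  by rewrite mcoeff_eq0 kq orbF subr_eq0 => /eqP.
rewrite -mdegE; apply: leq_trans (msize_mdeg_lt kq) _.
exact: leq_trans (Ssize _ Sq) lt.
Qed.

Lemma sep_degree_lower (X : finType) (c : X -> 'I_r -> nat) (x0 : X) (p d d' : nat) :
  prime p ->
  (forall a : X -> nat,
     is_relation (fun x i => (c x i)%:Z) nn (fun x => (a x)%:Z) ->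
     (\sum_x a x < d)%N -> (p %| a x0)%N) ->
  (exists2 a : X -> nat,
     is_relation (fun x i => (c x i)%:Z) nn (fun x => (a x)%:Z) & ~~ (p %| a x0)%N) ->
  sep_degree_bound F G d' -> (d <= d')%N.
Proof.
move=> pp short [a0 ra0 pa0].
apply: (@sep_degree_lower_ord #|X| (fun j => c (enum_val j)) (enum_rank x0) p) => //.
  move=> a ra ad; apply: (short (a \o enum_rank)) => [i|].
    have := ra i; rewrite (reindex (@enum_rank X)) /=; last exact: onW_bij (enum_rank_bij X).
    by under eq_bigr do rewrite enum_rankK.
  by move: ad; rewrite (reindex (@enum_rank X)) //=; apply: onW_bij (enum_rank_bij X).
exists (a0 \o enum_val); last by rewrite /= enum_rankK.
move=> i; have := ra0 i; rewrite (reindex (@enum_val X X)) //=.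
exact: onW_bij (enum_val_bij X).
Qed.

End Lower.

(** * The extremal characters *)

Lemma is_relation_nat (X : finType) r (c : X -> 'I_r -> nat) (m : 'I_r -> nat)
    (a : X -> nat) :
  is_relation (fun x i => (c x i)%:Z) m (fun x => (a x)%:Z) <->
  forall i, (m i %| \sum_x a x * c x i)%N.
Proof.
have E i : (\sum_x (a x)%:Z * (c x i)%:Z) = (\sum_x a x * c x i)%N.
  rewrite (big_morph Posz PoszD (erefl _)).
  by apply: eq_bigr => x _; rewrite PoszM.
by split=> ra i; have := ra i; rewrite E.
Qed.

Lemma sum_pairs (K : finType) (a : bool * K -> nat) :
  (\sum_x a x = \sum_k (a (false, k) + a (true, k)))%N.
Proof.
transitivity (\sum_b \sum_k a (b, k))%N.
  by rewrite pair_bigA; apply: eq_bigr => -[].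
by rewrite big_bool -big_split; apply: eq_bigr => k _; rewrite addnC.
Qed.

Section Pairs.
Variables (r h t e : nat) (n : nat -> nat).
Hypothesis ch : divisor_chain n r.
Let s := h.+1.
Hypotheses (st : (s <= t <= s.+1)%N) (tsr : (t + s)%N = r.+1).
Hypothesis e_t : e = 0%N \/ (s < t)%N.

(** The s pairs are indexed by k < s, and the pair k is attached to the
    component t + k.  The characters (true, k) with k > 0 have in addition the
    component k of the lower ones, and (true, ord0) has all the components
    below s, as well as e times the component s when t = s + 1. *)
Definition link (k : 'I_s) (i : nat) : nat :=
  if k == ord0 then ((i < s) + e * (i == s))%N else (i == k).

Definition pair_exponent (x : bool * 'I_s) (i : 'I_r) : nat :=
  ((i.+1 == t + x.2) + x.1 * link x.2 i.+1)%N.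

Implicit Type a : bool * 'I_s -> nat.

Lemma pair_sum a (i : 'I_r) :
  (\sum_x a x * pair_exponent x i =
   \sum_k (a (false, k) + a (true, k)) * (i.+1 == t + k) +
   \sum_k a (true, k) * link k i.+1)%N.
Proof.
rewrite sum_pairs -big_split; apply: eq_bigr => k _ /=.
rewrite /pair_exponent /=; move: (link k _) => l; lia.
Qed.

Lemma pair_sum_top a (i : 'I_r) (k : 'I_s) : i.+1 = (t + k)%N ->
  (\sum_x a x * pair_exponent x i = a (false, k) + a (true, k))%N.
Proof.
move=> ik; rewrite pair_sum (bigD1 k) //= ik eqxx muln1 [X in (_ + X + _)%N]big1; last first.
  by move=> l lk; rewrite eqn_add2l (inj_eq val_inj) eq_sym (negbTE lk) muln0.
rewrite addn0 big1 ?addn0 // => l _; rewrite /link.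
have lt_k : (t + k == l)%N = false by have := ltn_ord l; lia.
have lt_s : (t + k < s)%N = false by lia.
rewrite lt_k lt_s; case: e_t => [->|st']; first by rewrite mul0n if_same muln0.
have -> : (t + k == s)%N = false by lia.
by rewrite muln0 if_same muln0.
Qed.

Lemma pair_sum_low a (i : 'I_r) (k : 'I_s) : k != ord0 -> i.+1 = k ->
  (\sum_x a x * pair_exponent x i = a (true, ord0) + a (true, k))%N.
Proof.
move=> k0 ik; have ks := ltn_ord k; rewrite pair_sum big1; last first.
  move=> l _; have -> : (i.+1 == t + l)%N = false by lia.
  by rewrite muln0.
rewrite add0n (bigD1 ord0) //= (bigD1 k) //= /link eqxx (negbTE k0) ik ks.
have -> : (k == s :> nat) = false by lia.
rewrite eqxx muln0 addn0 !muln1 [X in (_ + (_ + X))%N]big1 ?addn0 // => l /andP[l0 lk].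
by rewrite (negbTE l0) (inj_eq val_inj) eq_sym (negbTE lk) muln0.
Qed.

Lemma pair_sum_mid a (i : 'I_r) : (s < t)%N -> i.+1 = s ->
  (\sum_x a x * pair_exponent x i = e * a (true, ord0))%N.
Proof.
move=> st' is_; rewrite pair_sum big1; last first.
  move=> l _; have -> : (i.+1 == t + l)%N = false by lia.
  by rewrite muln0.
rewrite add0n (bigD1 ord0) //= /link eqxx is_ ltnn eqxx muln1 add0n mulnC.
rewrite big1 ?addn0 // => l /negbTE l0; rewrite l0.
by rewrite gtn_eqF ?muln0 // ltn_ord.
Qed.

(** The entries 1 and n r - 1 add up to a multiple of every n i, and they are
    placed so that each congruence involves one of each. *)
Definition pair_witness (x : bool * 'I_s) : nat :=
  if x.1 == (x.2 == ord0) then 1%N else (n r).-1.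

Lemma pair_witnessP (i : 'I_r) : (i.+1 != s)%N || (s == t) ->
  (n i.+1 %| \sum_x pair_witness x * pair_exponent x i)%N.
Proof.
move=> hi; have ir := ltn_ord i.
have nr : (1 + (n r).-1 = n r)%N.
  by rewrite add1n prednK // (chain_gt0 ch) //; lia.
have ni : (n i.+1 %| n r)%N by apply: (chain_dvd ch).
have [ti|it] := leqP t i.+1.
  have ks : (i.+1 - t < s)%N by lia.
  rewrite (@pair_sum_top _ i (Ordinal ks)) /=; last by lia.
  rewrite /pair_witness /=; case: (_ == ord0) => /=; by rewrite ?nr // addnC nr.
have is_ : (i.+1 < s)%N by case/orP: hi => hi; lia.
rewrite (@pair_sum_low _ i (Ordinal is_)) //.
by rewrite /pair_witness /= nr.
Qed.

Variable p : nat.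
Hypothesis pn1 : (p %| n 1)%N.

(** The component k < s of the relation says that the exponents of (true, ord0)
    and (true, k) add up to 0 mod n k, hence mod p.  So no exponent of a
    (true, k) is divisible by p, no pair vanishes, and each pair has length at
    least n (t + k). *)
Lemma pairs_large a :
  (forall i : 'I_r, (i.+1 != s)%N || (s == t) -> (n i.+1 %| \sum_x a x * pair_exponent x i)%N) ->
  ~~ (p %| a (true, ord0))%N -> (\sum_(t <= i < r.+1) n i <= \sum_x a x)%N.
Proof.
move=> ra pa0.
have pk (k : 'I_s) : ~~ (p %| a (true, k))%N.
  have [->//|k0] := eqVneq k ord0.
  have k_gt0 : (0 < k)%N by rewrite lt0n.
  have ks := ltn_ord k.
  have kr : (k.-1 < r)%N by lia.
  have kK : k.-1.+1 = k by rewrite prednK.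
  have := ra (Ordinal kr); rewrite (@pair_sum_low a (Ordinal kr) k) //= kK ltn_eqF //.
  move/(_ isT) => nk; apply: contra pa0 => pk.
  rewrite -(dvdn_addl _ pk); apply: dvdn_trans nk.
  by apply: dvdn_trans pn1 _; apply: (chain_dvd ch) => //; lia.
rewrite sum_pairs.
rewrite -{1}[t]add0n big_addn -tsr addnC addnK big_mkord; apply: leq_sum => k _.
have ks := ltn_ord k.
have kr : ((t + k).-1 < r)%N by lia.
have kK : ((t + k).-1.+1 = t + k)%N by lia.
have := ra (Ordinal kr); rewrite (@pair_sum_top a (Ordinal kr) k) //= kK => H.
rewrite (addnC (k : nat) t); apply: dvdn_leq; last by apply: H; lia.
rewrite addn_gt0 lt0n; apply/orP; right; rewrite lt0n; apply: contra (pk k) => /eqP ->.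
exact: dvdn0.
Qed.

End Pairs.

Section Main.
Variables (R : realType) (gT : finGroupType) (G : {group gT}) (r : nat) (n : nat -> nat).
Hypotheses (r_gt0 : (0 < r)%N) (ch : divisor_chain n r).
Variable f : {morphism G >-> cyclic_sum r n}.
Hypotheses (f_inj : ('injm f)%g) (f_im : (f @* G)%g = [set: cyclic_sum r n]).

Let n_gt1 (i : 'I_r) : (1 < n i.+1)%N.
Proof. by apply: ch.1; rewrite ltn_ord. Qed.

Let n1_gt1 : (1 < n 1)%N. Proof. by apply: ch.1. Qed.

Lemma sep_bound_of_generated d : (n r <= d)%N ->
  (forall m (c : 'I_m -> 'I_r -> int), generated_below c (fun i => n i.+1) d) ->
  sep_degree_bound (complex R) G d.
Proof.
move=> nd gen; apply: (@sep_degree_bound_generated _ _ _ _ _ n_gt1 f f_inj f_im d (n r)) => //.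
  by apply: (chain_gt0 ch).
by move=> i; apply: (chain_dvd ch).
Qed.

(** The lower bound is attained by the pairs attached to the components
    s, ..., r. *)
Lemma noether_number_odd s : r = (2 * s - 1)%N ->
  is_sep_noether_number (complex R) G (\sum_(s <= i < r.+1) n i).
Proof.
move=> rs; have nd : (n r <= \sum_(s <= i < r.+1) n i)%N.
  by rewrite big_nat_recr /= ?leq_addl //; lia.
have nr : (0 < n r)%N by apply: (chain_gt0 ch).
split; first exact: leq_trans nd.
  apply: sep_bound_of_generated => // m c I p e a pp minI sa ra Pa.
  exact: (short_odd ch pp minI sa ra Pa r_gt0 rs).
move=> d' _; have [h sh] : exists h, s = h.+1 by exists s.-1; lia.
have [z zP] := primitive_roots (complex R) n_gt1.
have tsr : (s + h.+1)%N = r.+1 by lia.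
have st : (h.+1 <= s <= h.+2)%N by rewrite sh leqnn leqnSn.
have e_t : 0%N = 0%N \/ (h.+1 < s)%N by left.
have pn1 := pdiv_dvd (n 1).
apply: (@sep_degree_lower _ _ _ _ _ n_gt1 f f_inj f_im z zP _ (@pair_exponent r h s 0)
   (true, ord0) (pdiv (n 1))).
- by rewrite pdiv_prime.
- move=> a /is_relation_nat ra; apply: contraLR => pa; rewrite -leqNgt.
  exact: (pairs_large ch st tsr e_t pn1 _ pa).
exists (@pair_witness r h n).
  apply/is_relation_nat => i; apply: (pair_witnessP ch st tsr e_t).
  by rewrite sh eqxx orbT.
by rewrite /pair_witness /= dvdn1 neq_ltn prime_gt1 ?pdiv_prime // orbT.
Qed.

(** The lower bound is attained by the pairs attached to the components
    s + 1, ..., r, together with one character None of order n s.  The exponent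
    of None is linked to that of (true, ord0) by the component s, with the
    factor n s / p, so that it is a nonzero multiple of n s / p when p does not
    divide the exponent of (true, ord0). *)
Lemma noether_number_even s : r = (2 * s)%N ->
  is_sep_noether_number (complex R) G
    (n s %/ pdiv (n 1) + \sum_(s.+1 <= i < r.+1) n i).
Proof.
move=> rs; have nd : (n r <= n s %/ pdiv (n 1) + \sum_(s.+1 <= i < r.+1) n i)%N.
  by rewrite big_nat_recr /= ?addnA ?leq_addl //; lia.
have nr : (0 < n r)%N by apply: (chain_gt0 ch).
split; first exact: leq_trans nd.
  apply: sep_bound_of_generated => // m c I p e a pp minI sa ra Pa.
  exact: (short_even ch pp minI sa ra Pa r_gt0 rs).
move=> d' _; have [h sh] : exists h, s = h.+1 by exists s.-1; lia.
have [z zP] := primitive_roots (complex R) n_gt1.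
pose p := pdiv (n 1); pose e := (n s %/ p)%N.
have pp : prime p by rewrite pdiv_prime.
have sr : (s <= r)%N by lia.
have s0 : (0 < s)%N by lia.
have ep : (e * p = n s)%N.
  by rewrite divnK // (dvdn_trans (pdiv_dvd _)) // (chain_dvd ch).
have ns0 : (0 < n s)%N by apply: (chain_gt0 ch).
have e0 : (0 < e)%N by move: ns0; rewrite -ep muln_gt0 => /andP[].
have tsr : (s.+1 + h.+1)%N = r.+1 by lia.
have st : (h.+1 <= s.+1 <= h.+2)%N by rewrite sh leqnn leqnSn.
have e_t : e = 0%N \/ (h.+1 < s.+1)%N by right; rewrite sh.
have pn1 : (p %| n 1)%N := pdiv_dvd (n 1).
pose c (x : option (bool * 'I_h.+1)) (i : 'I_r) : nat :=
  if x is Some y then pair_exponent s.+1 e y i else (i.+1 == s).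
have sumO (F : option (bool * 'I_h.+1) -> nat) :
    (\sum_x F x = F None + \sum_y F (Some y))%N.
  rewrite (bigD1 None) //= (reindex_omap Some id) //=; last by case.
  by congr addn; apply: eq_bigl => y; rewrite eqxx.
have kr : (h < r)%N by lia.
have mid a : (\sum_x a x * c x (Ordinal kr) = a None + e * a (Some (true, ord0)))%N.
  have hs : (h.+1 == s)%N by rewrite sh.
  rewrite sumO /= hs muln1; congr addn.
  by rewrite (pair_sum_mid st tsr e_t (fun y => a (Some y))) //= -sh.
have other a (i : 'I_r) : i.+1 != s ->
    (\sum_x a x * c x i = \sum_y a (Some y) * pair_exponent s.+1 e y i)%N.
  by move=> /negbTE is_; rewrite sumO /= is_ muln0.
apply: (@sep_degree_lower _ _ _ _ _ n_gt1 f f_inj f_im z zP _ c (Some (true, ord0)) p) => //.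
- move=> a /is_relation_nat ra; apply: contraLR => pa; rewrite -leqNgt sumO leq_add //.
    have nh : n h.+1 = (e * p)%N by rewrite ep sh.
    have := ra (Ordinal kr); rewrite mid /= nh => ns_dvd.
    have : (e %| a None)%N.
      have eX : (e %| e * a (Some (true, ord0)))%N by apply: dvdn_mulr.
      by rewrite -(dvdn_addl _ eX); apply: dvdn_trans ns_dvd; apply: dvdn_mulr.
    case/dvdnP => y aE; rewrite -/p -/e aE leq_pmull // lt0n; apply: contra pa => /eqP y0.
    by move: ns_dvd; rewrite aE y0 mul0n add0n dvdn_pmul2l.
  apply: (pairs_large ch st tsr e_t pn1 _ pa (a := fun y => a (Some y))) => i.
  move=> hi; rewrite -other; first exact: ra.
  by case/orP: hi => [|/eqP [hs]]; [rewrite sh | clear -sh hs; lia].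
pose b (x : option (bool * 'I_h.+1)) : nat :=
  if x is Some y then pair_witness r n y else (n s - e)%N.
exists b; last by rewrite /b /pair_witness /= dvdn1 neq_ltn prime_gt1 // orbT.
apply/is_relation_nat => i; have [is_|is_] := eqVneq i.+1 s.
  have -> : i = Ordinal kr by apply: val_inj; rewrite /=; lia.
  have nh : n h.+1 = n s by rewrite sh.
  by rewrite mid /b /pair_witness /= muln1 subnK ?leq_div // nh.
rewrite other //; apply: (pair_witnessP ch st tsr e_t).
by move: is_; rewrite {1}sh => ->.
Qed.

End Main.

Local Close Scope ring_scope.

Theorem theorem1p3 (R : realType) (gT : finGroupType) (G : {group gT})
    (r : nat) (n : nat -> nat)
    (r_ge1 : 1 <= r)
    (n_gt1 : forall i, 1 <= i <= r -> 1 < n i)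
    (n_dvd : forall i, 1 <= i < r -> n i %| n i.+1)
    (G_isog : (G \isog [set: cyclic_sum r n])%g) :
  (forall s : nat, r = 2 * s - 1 ->
     is_sep_noether_number (complex R) G (\sum_(s <= i < r.+1) n i)) /\
  (forall s : nat, r = 2 * s ->
     is_sep_noether_number (complex R) G
       (n s %/ pdiv (n 1) + \sum_(s.+1 <= i < r.+1) n i)).
Proof.
have [f f_inj f_im] := isogP G_isog.
have ch : divisor_chain n r by [].
split=> s; first exact: (noether_number_odd R r_ge1 ch f_inj f_im).
exact: (noether_number_even R r_ge1 ch f_inj f_im).
Qed.
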